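(* Let $\Gamma=(G,\omega,\ell)$ be a weighted tropical curve of genus $g$ and let $D\in\operatorname{Div}(\Gamma)$. Then: (1) the number $r_{\Gamma^\omega_\epsilon}(\iota_\epsilon(D))$ is independent of $\epsilon>0$; define $r_\Gamma(D):=r_{\Gamma^\omega_\epsilon}(\iota_\epsilon(D))$; (2) (Riemann–Roch) $r_\Gamma(D)-r_\Gamma(K_\Gamma-D)=\deg D-g+1$.
   Context: Graphs are finite and connected, loops and multiple edges allowed. A weighted tropical curve is $\Gamma=(G,\omega,\ell)$ with $\omega:V(G)\to\mathbb{Z}_{\ge0}$ and $\ell:E(G)\to\mathbb{R}_{>0}$; its genus is $g=b_1(G)+\sum_v\omega(v)$ with $b_1(G)=|E|-|V|+1$. It is pure if $\omega\equiv0$. The metric graph $(G,\ell)$ is regarded as the metric space obtained by gluing segments of length $\ell(e)$ along $G$. For a pure tropical curve, $\operatorname{Div}$ is the free abelian group on its points; a rational function is a continuous $f$ whose restriction to each edge is piecewise affine with integer slopes and finitely many pieces; $\operatorname{ord}_p f$ is the sum of the outgoing slopes of $f$ at $p$ over all segments emanating from $p$; $\operatorname{div}(f)=\sum_p\operatorname{ord}_p(f)p$; principal divisors are the $\operatorname{div}(f)$; $D\sim D'$ iff $D-D'$ is principal. With $R(D)$ the set of rational functions $f$ with $\operatorname{div}(f)+D\ge0$, the rank is $r(D)=\max\{k: R(D-E)\ne\emptyset$ for all effective $E$ of degree $k\}$ (so $r(D)=-1$ iff $R(D)=\emptyset$). For weighted $\Gamma$, $\operatorname{Div}(\Gamma)$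 is the free abelian group on the points of the metric graph $(G,\ell)$, and $K_\Gamma=\sum_{v\in V(G)}(\operatorname{val}(v)+2\omega(v)-2)v$ with $\operatorname{val}$ the valency in $G$. For $\epsilon>0$, $\Gamma^\omega_\epsilon$ is the pure tropical curve obtained from $(G,\ell)$ by attaching at each vertex $v$ exactly $\omega(v)$ loops of length $\epsilon$, and $\iota_\epsilon:\operatorname{Div}(\Gamma)\to\operatorname{Div}(\Gamma^\omega_\epsilon)$ is the natural inclusion. *)

(* Defs.v *)
From HB Require Import structures.
From mathcomp Require Import all_boot all_order all_algebra.
From mathcomp Require Import reals.
Set Implicit Arguments. Unset Strict Implicit. Unset Printing Implicit Defensive.
Import Order.TTheory GRing.Theory Num.Theory.
Local Open Scope ring_scope.

(* A graph: finite vertex type V, finite edge type E, endpoints src/tgt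
   (loops and multiple edges allowed).  A metric graph additionally has
   edge lengths len : E -> R (positive).  Points of the metric graph are
   represented by [inl v] (a vertex) or [inr (e, t)] with 0 < t < len e
   (the interior point of e at distance t from src e). *)

Definition connected_graph (V E : finType) (src tgt : E -> V) : Prop :=
  forall u v : V, connect (fun x y : V =>
     [exists e : E, ((src e == x) && (tgt e == y)) || ((src e == y) && (tgt e == x))]) u v.

Section PureTropicalCurve.
Context (R : realType) (V E : finType) (src tgt : E -> V) (len : E -> R).

Definition pt := (V + (E * R))%type.

Definition valid_pt (p : pt) : bool :=
  match p with inl _ => true | inr (e, t) => (0 < t) && (t < len e) end.

(* Divisors: elements of the free abelian group on the points, written as
   finite formal sums  sum_i n_i p_i  (lists of (point, coefficient)). *)
Definition divisor := seq (pt * int).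
Definition is_div (D : divisor) : bool := all (fun q => valid_pt q.1) D.
Definition coef (D : divisor) (p : pt) : int := \sum_(q <- D | q.1 == p) q.2.
Definition deg (D : divisor) : int := \sum_(q <- D) q.2.
Definition div_sub (D1 D2 : divisor) : divisor := D1 ++ [seq (q.1, - q.2) | q <- D2].
Definition effective (D : divisor) : Prop := forall p, 0 <= coef D p.

Definition edge_fun (f : pt -> R) (e : E) (t : R) : R :=
  if t == 0 then f (inl (src e))
  else if t == len e then f (inl (tgt e))
  else f (inr (e, t)).

Definition PL_on (a b : R) (phi : R -> R) : Prop :=
  exists (n : nat) (x : nat -> R) (s : nat -> int),
    [/\ x 0%N = a, x n = b,
        forall i, (i < n)%N -> x i < x i.+1 &
        forall i, (i < n)%N -> forall t, x i <= t <= x i.+1 ->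
          phi t = phi (x i) + (s i)%:~R * (t - x i)].

Definition rational_fun (f : pt -> R) : Prop :=
  forall e, PL_on 0 (len e) (edge_fun f e).

Definition out_slope (phi : R -> R) (t dir : R) (s : int) : Prop :=
  exists2 d, 0 < d & forall h, 0 < h < d -> phi (t + dir * h) = phi t + s%:~R * h.

Definition ord_is (f : pt -> R) (p : pt) (n : int) : Prop :=
  match p with
  | inl v => exists a b : E -> int,
      [/\ forall e, src e = v -> out_slope (edge_fun f e) 0 1 (a e),
          forall e, tgt e = v -> out_slope (edge_fun f e) (len e) (-1) (b e) &
          n = \sum_(e | src e == v) a e + \sum_(e | tgt e == v) b e]
  | inr (e, t) => exists a b : int,
      [/\ out_slope (edge_fun f e) t 1 a, out_slope (edge_fun f e) t (-1) b & n = a + b]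
  end.

Definition RD_nonempty (D : divisor) : Prop :=
  exists f : pt -> R, rational_fun f /\
    forall p, valid_pt p -> exists n, ord_is f p n /\ 0 <= n + coef D p.

Definition rank_ok (D : divisor) (k : int) : Prop :=
  forall E0 : divisor, is_div E0 -> effective E0 -> deg E0 = k ->
    RD_nonempty (div_sub D E0).

Definition is_rank (D : divisor) (r : int) : Prop :=
  rank_ok D r /\ forall k, rank_ok D k -> k <= r.

End PureTropicalCurve.

Section Weighted.
Context (R : realType) (V E : finType) (src tgt : E -> V) (w : V -> nat) (len : E -> R).

Definition loop_edge := {v : V & 'I_(w v)}.
Definition aug_edge : finType := (E + loop_edge)%type.
Definition aug_src (e : aug_edge) : V :=
  match e with inl e0 => src e0 | inr x => tag x end.
Definition aug_tgt (e : aug_edge) : V :=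
  match e with inl e0 => tgt e0 | inr x => tag x end.
Definition aug_len (eps : R) (e : aug_edge) : R :=
  match e with inl e0 => len e0 | inr _ => eps end.

Definition iota_pt (p : pt R V E) : pt R V aug_edge :=
  match p with inl v => inl v | inr (e, t) => inr (inl e, t) end.
Definition iota_div (D : divisor R V E) : divisor R V aug_edge :=
  [seq (iota_pt q.1, q.2) | q <- D].

Definition valency (v : V) : nat := (#|[pred e | src e == v]| + #|[pred e | tgt e == v]|)%N.

Definition canonical_div : divisor R V E :=
  [seq (inl v, (valency v)%:Z + 2 * (w v)%:Z - 2) | v <- enum V].

Definition genus : int := (#|E|)%:Z - (#|V|)%:Z + 1 + (\sum_v w v)%:Z.

Definition weighted_rank_at (eps : R) (D : divisor R V E) (r : int) : Prop :=
  is_rank aug_src aug_tgt (aug_len eps) (iota_div D) r.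

End Weighted.

(* Main.v *)
(** Independence of [eps]: scaling a rational function along a loop, relative to
    its value at the base vertex, preserves all slopes, so it carries
    R(D - E) for one loop length to R(D - E') for another.

    Riemann-Roch reduces to: if R(F) is empty then there is an effective G of
    degree g - 1 - deg F with R(K - F - G) empty.  After subdividing, F lives on
    the vertices, and R(F) is nonempty iff some y : V -> R satisfies
    F(v) + sum floor((y(u) - y(v)) / l) >= 0 at every vertex v, the sum ranging
    over the edges from v to u of length l.  Fix a vertex q.  Since the floor is
    upper semicontinuous, the pointwise supremum of the y with y(q) = 0 which are
    good away from q is again good there, and it yields a q-reduced divisor F'
    equivalent to F.  If R(F) is empty, Dhar's burning algorithm on the subdivision
    at the breakpoints burns everything: this orders the vertices so that
    F' <= nu, where nu(v) + 1 counts the edges from v to earlier vertices.  Take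
    G = nu - F'; then K - F - G ~ K - nu, which has no sections because K - nu + 1
    counts the edges to later vertices (look at the last vertex where a function
    attains its maximum). *)
Require Import Defs.
From HB Require Import structures.
From mathcomp Require Import all_boot all_order all_algebra.
From mathcomp Require Import boolp reals.
From mathcomp Require Import zify ring lra.
Import Order.TTheory GRing.Theory Num.Theory.
Local Open Scope ring_scope.

Set Implicit Arguments. Unset Strict Implicit. Unset Printing Implicit Defensive.

(** * Dhar's burning algorithm *)

Section Incidence.
Context (V E : finType) (src tgt : E -> V).

(** [a] labels the source half-edges and [b] the target ones, so a loop counts twice. Degrees,
    orders of functions and flows all have this form, and [le_inc] compares them half-edge by
    half-edge. *)
Definition inc (a b : E -> int) (v : V) : int :=
  \sum_(e | src e == v) a e + \sum_(e | tgt e == v) b e.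

Lemma sum_inc (a b : E -> int) : \sum_v inc a b v = \sum_e (a e + b e).
Proof.
rewrite big_split big_split /=; congr (_ + _).
- by rewrite (partition_big src xpredT).
- by rewrite (partition_big tgt xpredT).
Qed.

Lemma le_inc (a b a' b' : E -> int) v :
  (forall e, src e = v -> a e <= a' e) -> (forall e, tgt e = v -> b e <= b' e) ->
  inc a b v <= inc a' b' v.
Proof. by move=> ha hb; apply: lerD; apply: ler_sum => e /eqP; [apply: ha|apply: hb]. Qed.

Lemma eq_inc (a b a' b' : E -> int) v :
  (forall e, src e = v -> a e = a' e) -> (forall e, tgt e = v -> b e = b' e) ->
  inc a b v = inc a' b' v.
Proof. by move=> ha hb; congr (_ + _); apply: eq_bigr => e /eqP; [apply: ha|apply: hb]. Qed.

Lemma incD (a b a' b' : E -> int) v :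
  inc (fun e => a e + a' e) (fun e => b e + b' e) v = inc a b v + inc a' b' v.
Proof. by rewrite /inc !big_split /=; ring. Qed.

Lemma incB (a b a' b' : E -> int) v :
  inc (fun e => a e - a' e) (fun e => b e - b' e) v = inc a b v - inc a' b' v.
Proof. by rewrite /inc !big_split /= !sumrN; ring. Qed.

Lemma incN (a b : E -> int) v : inc (fun e => - a e) (fun e => - b e) v = - inc a b v.
Proof. by rewrite /inc !sumrN; ring. Qed.

Lemma inc_ge1 (a b : E -> int) v e :
  (forall e, src e = v -> 0 <= a e) -> (forall e, tgt e = v -> 0 <= b e) ->
  (src e = v /\ 1 <= a e) \/ (tgt e = v /\ 1 <= b e) -> 1 <= inc a b v.
Proof.
move=> ha hb; have sa : 0 <= \sum_(e | src e == v) a e.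
  by apply: sumr_ge0 => i /eqP; apply: ha.
have sb : 0 <= \sum_(e | tgt e == v) b e by apply: sumr_ge0 => i /eqP; apply: hb.
case=> -[/eqP he h1]; rewrite /inc.
- rewrite (bigD1 e he) /=.
  have : 0 <= \sum_(i | (src i == v) && (i != e)) a i.
    by apply: sumr_ge0 => i /andP[/eqP ? _]; apply: ha.
  lra.
- rewrite [X in _ + X](bigD1 e he) /=.
  have : 0 <= \sum_(i | (tgt i == v) && (i != e)) b i.
    by apply: sumr_ge0 => i /andP[/eqP ? _]; apply: hb.
  lra.
Qed.

Definition degree (v : V) : int := inc (fun=> 1) (fun=> 1) v.

(** For [v] in [S], the number of chips that [v] loses when [S] is fired. *)
Definition outdeg (S : {set V}) : V -> int :=
  inc (fun e => (tgt e \notin S)%:R) (fun e => (src e \notin S)%:R).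

(** The indegree of the acyclic orientation that directs every edge towards its end of larger
    [rho]. *)
Definition indeg (rho : V -> nat) : V -> int :=
  inc (fun e => (rho (tgt e) < rho (src e))%N%:R)
      (fun e => (rho (src e) < rho (tgt e))%N%:R).

(** Fire spreads from [q], burning [v] once more than [c v] of its edges lead to burnt vertices. If
    it stops early, the unburnt set is [S]; otherwise [rho] is the order of burning. *)
Lemma dhar_burning (c : V -> int) (q : V) :
  (exists S : {set V}, [/\ S != set0, q \notin S & {in S, forall v, outdeg S v <= c v}]) \/
  (exists rho : V -> nat,
     [/\ injective rho, rho q = 0%N & forall v, v != q -> c v < indeg rho v]).
Proof.
have [n] := ubnP (#|V| - 1)%N.
(* The list [s] holds the burnt vertices in order of burning. An unburnt vertex has index [size s],
   so it counts as later than all of [s], and appending it leaves the indegrees on [s] unchanged. *)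
pose good s := forall v, v \in s -> v != q -> c v < indeg (index^~ s) v.
have: good [:: q] by move=> v; rewrite inE => /eqP ->; rewrite eqxx.
have: uniq [:: q] by [].
have: index q [:: q] = 0%N by rewrite /= eqxx.
have: q \in [:: q] by rewrite inE.
have -> : 1%N = size [:: q] by [].
elim: n [:: q] => // n IH s qs q0 us gs hn.
have [/eqP S0|[v0 v0S]] := set_0Vmem [set v | v \notin s].
  have ins v : v \in s.
    by apply/negPn; move/eqP/setP/(_ v): S0; rewrite !inE => ->.
  right; exists (index^~ s); split=> // [u v huv|v]; last exact: gs.
  by rewrite -(nth_index q (ins u)) huv nth_index.
have [hS|] := pselect {in [set v | v \notin s], forall v, outdeg [set v | v \notin s] v <= c v}.
  left; exists [set v | v \notin s]; split=> //; last by rewrite inE negbK.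
  by apply/set0Pn; exists v0.
case/existsNP => v /not_implyP[]; rewrite inE => vs /negP; rewrite -ltNge => cv.
have ltix u w : u \in s -> (index w (rcons s v) < index u (rcons s v))%N = (index w s < index u s)%N.
  move=> us'; rewrite -cats1 !index_cat us'; case: ifP => // /negbT ws.
  by move: us'; rewrite -index_mem (memNindex ws); lia.
apply: (IH (rcons s v)).
- by rewrite mem_rcons inE qs orbT.
- by rewrite -cats1 index_cat qs.
- by rewrite rcons_uniq vs.
- move=> u; rewrite mem_rcons inE => /orP[/eqP -> _|us' uq]; last first.
    apply: (lt_le_trans (gs _ us' uq)); apply: le_inc => e he; rewrite he ltix //.
  apply: (lt_le_trans cv); apply: le_inc => e he; rewrite he inE negbK.
    case: (boolP (tgt e \in s)) => // hs.
    by rewrite -cats1 !index_cat hs (negPf vs) /= eqxx addn0 index_mem hs.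
  case: (boolP (src e \in s)) => // hs.
  by rewrite -cats1 !index_cat hs (negPf vs) /= eqxx addn0 index_mem hs.
- rewrite size_rcons; have : (size s < #|V|)%N.
    have := uniq_leq_size (s1 := v :: s) (s2 := enum V); rewrite /= vs us /= -cardE; apply=> //.
    by move=> x _; rewrite mem_enum.
  lia.
Qed.

Definition cut_connected :=
  forall S : {set V}, S != set0 -> S != setT -> exists e, (src e \in S) != (tgt e \in S).

(** Burning with [c = 0]: a set that resists the fire has no edge leaving it, which connectedness
    excludes. *)
Lemma spanning_order (q : V) : cut_connected ->
  exists rho : V -> nat, [/\ injective rho, rho q = 0%N &
    forall v, v != q -> 0 < indeg rho v].
Proof.
move=> conn; have [[S [S0 qS hS]]|//] := dhar_burning (fun=> 0) q.
have ST : S != setT by apply: contra qS => /eqP ->.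
have [e he] := conn S S0 ST.
have [v vS h1] : exists2 v, v \in S & 1 <= outdeg S v.
  case: (boolP (src e \in S)) he => sS; case: (boolP (tgt e \in S)) => tS // _.
  - by exists (src e) => //; apply: (inc_ge1 (e := e)) => // *; left; rewrite tS.
  - by exists (tgt e) => //; apply: (inc_ge1 (e := e)) => // *; right; rewrite sS.
by have := hS v vS; lia.
Qed.

End Incidence.

(** * Rational functions through their vertex values *)

Lemma uniform_radius (R : realFieldType) (I : finType) (P : I -> R -> Prop) :
  (forall i, exists d, 0 < d /\ forall h, h < d -> P i h) ->
  exists2 d, 0 < d & forall i h, h < d -> P i h.
Proof.
move=> /choice[d hd]; have d0 i : 0 < d i by have [] := hd i.
have s0 : 0 <= \sum_i (d i)^-1 by apply: sumr_ge0 => i _; rewrite invr_ge0 ltW.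
(* This number is at most every [d i], and positive even for empty [I]. *)
exists (1 + \sum_i (d i)^-1)^-1 => [|i h hh]; first by rewrite invr_gt0; lra.
have [_] := hd i; apply; apply: (lt_le_trans hh).
rewrite -[leRHS]invrK lef_pV2 ?posrE ?invr_gt0 //; last lra.
rewrite (bigD1 i) //=; have : 0 <= \sum_(j | j != i) (d j)^-1.
  by apply: sumr_ge0 => j _; rewrite invr_ge0 ltW.
lra.
Qed.

Section Flow.
Context (R : realType) (V E : finType) (src tgt : E -> V) (len : E -> R).
Hypothesis len_gt0 : forall e, 0 < len e.
Implicit Types (F : V -> int) (y : V -> R).

Lemma sum_inc_in (S : {set V}) (a b : E -> int) :
  \sum_(v in S) inc src tgt a b v =
  \sum_e ((if src e \in S then a e else 0) + (if tgt e \in S then b e else 0)).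
Proof.
rewrite big_split [RHS]big_split /= -!big_mkcond /=; congr (_ + _).
- by rewrite [RHS](partition_big src (mem S)) //=; apply: eq_bigr => v vS;
    apply: eq_bigl => e; case: eqP => [->|]; rewrite ?vS ?andbF.
- by rewrite [RHS](partition_big tgt (mem S)) //=; apply: eq_bigr => v vS;
    apply: eq_bigl => e; case: eqP => [->|]; rewrite ?vS ?andbF.
Qed.

Lemma incZ (M : int) (a b : E -> int) v :
  inc src tgt (fun e => M * a e) (fun e => M * b e) v = M * inc src tgt a b v.
Proof. by rewrite /inc -!mulr_sumr mulrDr. Qed.

(* Values prescribed at the vertices extend over an edge to a function with
   nonnegative orders inside it; its outgoing slopes at the two ends are at most
   these rounded-down slopes, and both bounds are reached simultaneously. *)
Definition flow (y : V -> R) : V -> int :=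
  inc src tgt (fun e => Num.floor ((y (tgt e) - y (src e)) / len e))
              (fun e => Num.floor ((y (src e) - y (tgt e)) / len e)).

Definition vertex_nonempty (F : V -> int) : Prop :=
  exists y, forall v, 0 <= F v + flow y v.

Lemma floorN_le0 (x : R) : Num.floor x + Num.floor (- x) <= 0.
Proof.
by rewrite -(ler_int R) rmorphD /=; have := floor_le x; have := floor_le (- x); lra.
Qed.

Lemma flow_edge_le0 y e :
  Num.floor ((y (tgt e) - y (src e)) / len e) + Num.floor ((y (src e) - y (tgt e)) / len e) <= 0.
Proof. by rewrite -[y (src e) - _]opprB mulNr floorN_le0. Qed.

Lemma sum_flow_le0 y : \sum_v flow y v <= 0.
Proof. by rewrite sum_inc; apply: sumr_le0 => e _; apply: flow_edge_le0. Qed.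

Lemma vertex_nonempty_sum F : vertex_nonempty F -> 0 <= \sum_v F v.
Proof.
move=> [y hy]; have : 0 <= \sum_v (F v + flow y v) by apply: sumr_ge0.
by rewrite big_split /=; have := sum_flow_le0 y; lra.
Qed.

Definition admissible F (q : V) (y : V -> R) : Prop :=
  y q = 0 /\ forall v, v != q -> 0 <= F v + flow y v.

Lemma len_le_sum e : len e <= \sum_e len e.
Proof.
by rewrite (bigD1 e) //= lerDl; apply: sumr_ge0 => i _; apply: ltW.
Qed.

Lemma flow_shift k y v : flow (fun u => y u + k) v = flow y v.
Proof.
by apply: eq_inc => e _; congr (Num.floor (_ / _)); lra.
Qed.

(** Vertices are made good in decreasing order of [rho]. Raising all earlier vertices by a large
    constant adds slope at [v] towards an earlier neighbour, and does no harm to later vertices,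
    which are not raised themselves. *)
Lemma exists_admissible F q : cut_connected src tgt -> exists y, admissible F q y.
Proof.
move=> /(spanning_order q)[rho [rinj rq hrho]].
have rho_gt0 v : v != q -> (0 < rho v)%N.
  by move=> vq; rewrite lt0n; apply: contra vq => /eqP h; apply/eqP/rinj; rewrite h rq.
pose N := \max_v rho v.
suff /(_ N.+1)[y hy] : forall j, exists y, forall v, v != q -> (N < rho v + j)%N -> 0 <= F v + flow y v.
  exists (fun u => y u - y q); split=> [|v vq]; first by rewrite subrr.
  by rewrite flow_shift hy // ?rho_gt0 //; lia.
elim=> [|j [y hy]].
  exists (fun=> 0) => v _; rewrite addn0 ltnNge; apply: contraNP => _.
  exact: (leq_bigmax_cond (F := rho)).
pose M : int := \sum_v `|F v + flow y v|; pose L := \sum_e len e.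
have M0 : 0 <= M by apply: sumr_ge0.
have ML e : 0 <= M%:~R * L - M%:~R * len e.
  by rewrite -mulrBr mulr_ge0 ?ler0z // subr_ge0 len_le_sum.
have ML0 : 0 <= M%:~R * L.
  by rewrite mulr_ge0 ?ler0z //; apply: sumr_ge0 => i _; apply: ltW.
(* [M] bounds every deficit and [L] every edge length, so a raise by [M * L] lifts the rounded slope
   towards a raised vertex by at least [M]. *)
pose y' u := y u + if (rho u < N - j)%N then M%:~R * L else 0.
have step e (x : R) (b : bool) :
    Num.floor (x / len e) + M * b%:R <= Num.floor ((x + if b then M%:~R * L else 0) / len e).
  rewrite floor_ge_int rmorphD /= ler_pdivlMr //.
  have : (Num.floor (x / len e))%:~R * len e <= x by rewrite -ler_pdivlMr // floor_le.
  by case: b; have := ML e; rewrite ?mulr1 ?mulr0; lra.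
exists y' => v vq hv.
have : flow y v + M * inc src tgt (fun e => (rho (tgt e) < N - j)%N%:R)
                   (fun e => (rho (src e) < N - j)%N%:R) v <= flow y' v.
  rewrite -incZ -incD; apply: le_inc => e he.
    have := step e (y (tgt e) - y (src e)) (rho (tgt e) < N - j)%N.
    move/le_trans; apply; apply: le_floor; rewrite ler_pM2r ?invr_gt0 // /y' he.
    have -> : (rho v < N - j)%N = false by apply/negbTE; rewrite -leqNgt; lia.
    lra.
  have := step e (y (src e) - y (tgt e)) (rho (src e) < N - j)%N.
  move/le_trans; apply; apply: le_floor; rewrite ler_pM2r ?invr_gt0 // /y' he.
  have -> : (rho v < N - j)%N = false by apply/negbTE; rewrite -leqNgt; lia.
  lra.
have [old|new] := ltnP N (rho v + j).
  have := hy v vq old.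
  set X := inc _ _ _ _ _; have : 0 <= X by apply: addr_ge0; apply: sumr_ge0.
  by move=> X0; have := mulr_ge0 M0 X0; lra.
have -> : (N - j)%N = rho v by lia.
have -> : inc src tgt (fun e => (rho (tgt e) < rho v)%N%:R)
    (fun e => (rho (src e) < rho v)%N%:R) v = indeg src tgt rho v.
  by apply: eq_inc => e ->.
have h1 : `|F v + flow y v| <= M by rewrite /M (bigD1 v) //= lerDl sumr_ge0.
have : - (F v + flow y v) <= M by apply: le_trans h1; rewrite -normrN ler_norm.
have := hrho v vq; set I := indeg _ _ _ _ => I0.
have : M * 1 <= M * I by apply: ler_wpM2l => //; lia.
lra.
Qed.

(** Induction on the number of vertices below [v]. If [y v > 0], the superlevel set [S] omits [q],
    so its total flow is at least minus the sum of the absolute values of [F]. No edge contributes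
    positively to it, so an edge leaving [S] drops by at most [K], to a vertex lower than [v]. *)
Lemma admissible_le F q y u : cut_connected src tgt -> admissible F q y ->
  y u <= #|V|%:R * ((\sum_v `|F v|)%:~R * \sum_e len e).
Proof.
move=> conn [yq hy]; set K := _ * \sum_e _; pose low u := [set w | y w < y u].
have K0 : 0 <= K.
  by rewrite mulr_ge0 ?ler0z ?sumr_ge0 // => e _; apply: ltW.
suff H v : y v <= #|low v|%:R * K.
  by apply: (le_trans (H u)); rewrite ler_wpM2r // ler_nat max_card.
have [n] := ubnP #|low v|; elim: n v => // n IH v hv.
have [vle0|v0] := leP (y v) 0; first by apply: (le_trans vle0); rewrite mulr_ge0.
pose S := [set w | y v <= y w].
have qS : q \notin S by rewrite inE yq -ltNge.
have S0 : S != set0 by apply/set0Pn; exists v; rewrite inE.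
have ST : S != setT by apply: contra qS => /eqP ->.
have [e he] := conn S S0 ST.
have hsum : - \sum_v `|F v| <= \sum_(v in S) flow y v.
  have : 0 <= \sum_(v in S) (F v + flow y v).
    by apply: sumr_ge0 => w wS; apply: hy; apply: contraNneq qS => <-.
  have : \sum_(v in S) F v <= \sum_(v in S) `|F v| by apply: ler_sum => w _; apply: ler_norm.
  have : \sum_(v in S) `|F v| <= \sum_v `|F v|.
    by rewrite [leRHS](bigID (mem S)) /= lerDl sumr_ge0.
  by rewrite big_split /=; lra.
have [x [w [xS wS hle]]] : exists x w, [/\ y v <= y x, y w < y v &
   (- \sum_v `|F v|)%:~R <= (y w - y x) / len e].
  move: hsum; rewrite sum_inc_in (bigD1 e) //=.
  set T := \sum_(i | i != e) _; have T0 : T <= 0.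
    (* An edge inside [S] contributes the floors of two opposite numbers, an edge leaving [S] the
       floor of a negative slope. *)
    apply: sumr_le0 => i _; have := flow_edge_le0 y i; rewrite !inE.
    case: (leP (y v) (y (src i))) => h1; case: (leP (y v) (y (tgt i))) => h2; rewrite ?addr0 ?add0r // => _;
      by rewrite floor_le0 ltr_pdivrMr // mul1r; have := len_gt0 i; lra.
  move: he; rewrite !inE; case: (leP (y v) (y (src e))) => h1; case: (leP (y v) (y (tgt e))) => h2 // _;
    rewrite ?addr0 ?add0r => hs;
    [exists (src e), (tgt e)|exists (tgt e), (src e)]; split=> //;
    by rewrite -floor_ge_int; lra.
have hxw : y x <= y w + K.
  move: hle; rewrite ler_pdivlMr // rmorphN /= mulNr => hle.
  have : (\sum_v `|F v|)%:~R * len e <= K.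
    by apply: ler_wpM2l (len_le_sum e); rewrite ler0z sumr_ge0.
  lra.
have wv : (#|low w| < #|low v|)%N.
  apply/proper_card/properP; split; last by exists w; rewrite !inE ?ltxx.
  by apply/subsetP => z; rewrite !inE => /lt_trans; apply.
have : y w <= #|low w|%:R * K by apply: IH; apply: leq_trans wv _; rewrite -ltnS.
have : (#|low w|.+1)%:R * K <= #|low v|%:R * K by rewrite ler_wpM2r // ler_nat.
by rewrite -natr1 mulrDl mul1r; lra.
Qed.

Lemma exists_max_admissible F q : cut_connected src tgt ->
  exists2 y, admissible F q y & forall y', admissible F q y' -> forall v, y' v <= y v.
Proof.
move=> conn; have [y0 hy0] := exists_admissible F q conn.
pose A v (x : R) := exists2 y, admissible F q y & y v = x.
have supA v : classical_sets.has_sup (A v).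
  split; first by exists (y0 v); exists y0.
  exists (#|V|%:R * ((\sum_v `|F v|)%:~R * \sum_e len e)) => _ [y hy <-].
  exact: (admissible_le _ conn hy).
pose ys v := sup (A v).
have le_ys y v : admissible F q y -> y v <= ys v.
  by move=> hy; apply: sup_upper_bound => //; exists y.
exists ys => [|y' hy' v]; last exact: le_ys.
split.
  apply/eqP; rewrite eq_le -{2}hy0.1 le_ys // andbT.
  by apply: ge_sup; [exists (y0 q); exists y0|move=> _ [y [-> _] <-]].
move=> v vq.
(* The floor is right continuous. *)
have gap (x l : R) : 0 < l -> exists d, 0 < d /\ forall h, h < d ->
    Num.floor ((x + h) / l) <= Num.floor (x / l).
  move=> l0; exists (l * ((Num.floor (x / l) + 1)%:~R - x / l)).
  split=> [|h]; first by rewrite mulr_gt0 // subr_gt0 floorD1_gt.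
  rewrite mulrBr [l * (x / l)]mulrC divfK ?gt_eqF // => hh.
  by rewrite -ltzD1 floor_lt_int ltr_pdivrMr // ; lra.
have [d1 d1_gt0 hd1] := uniform_radius (fun e => gap (ys (tgt e) - ys (src e)) _ (len_gt0 e)).
have [d2 d2_gt0 hd2] := uniform_radius (fun e => gap (ys (src e) - ys (tgt e)) _ (len_gt0 e)).
have d_gt0 : 0 < Num.min d1 d2 by rewrite lt_min d1_gt0.
(* One [y] nearly optimal at [v] suffices: it lies below [ys] elsewhere, so its differences along
   the edges at [v] exceed those of [ys] by less than [d1] and [d2], which the floors do not
   notice. *)
have [_ [y hy <-] hyv] := sup_adherent d_gt0 (supA v).
have m1 : Num.min d1 d2 <= d1 by rewrite ge_min lexx.
have m2 : Num.min d1 d2 <= d2 by rewrite ge_min lexx orbT.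
have {}hyv : ys v - Num.min d1 d2 < y v := hyv.
apply: (le_trans (hy.2 v vq)); rewrite lerD2l; apply: le_inc => e he.
- apply: le_trans (hd1 e (ys v - y v) _); last first.
    by lra.
  rewrite he; apply: le_floor; rewrite ler_pM2r ?invr_gt0 //.
  by have := le_ys y (tgt e) hy; lra.
- apply: le_trans (hd2 e (ys v - y v) _); last first.
    by lra.
  rewrite he; apply: le_floor; rewrite ler_pM2r ?invr_gt0 //.
  by have := le_ys y (src e) hy; lra.
Qed.

End Flow.

(** * Functions with integral slopes and chip firing *)

Section IntegralSlopes.
Context (R : realType) (V E : finType) (src tgt : E -> V) (len : E -> R).
Hypothesis len_gt0 : forall e, 0 < len e.
Context (y : V -> R) (s : E -> int).
Hypothesis slope : forall e, y (tgt e) - y (src e) = (s e)%:~R * len e.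

Let len_neq0 e : len e != 0. Proof. by rewrite gt_eqF. Qed.

(** Integers come out of the floors, so adding [y] changes the flow by exactly the divisor of [y].
    This is linear equivalence in terms of flows. *)
Lemma flowD_int z v :
  flow src tgt len (fun u => z u + y u) v =
  flow src tgt len z v + inc src tgt s (fun e => - s e) v.
Proof.
have floorDint (x : R) (n : int) : Num.floor (x + n%:~R) = Num.floor x + n.
  by rewrite floorDrz ?intr_int // intrKfloor.
rewrite -incD; apply: eq_inc => e _; rewrite -floorDint; congr (Num.floor _).
- have -> : z (tgt e) + y (tgt e) - (z (src e) + y (src e)) =
    z (tgt e) - z (src e) + (s e)%:~R * len e by rewrite -slope; ring.
  by rewrite mulrDl mulfK.
- have -> : z (src e) + y (src e) - (z (tgt e) + y (tgt e)) =
    z (src e) - z (tgt e) + (- s e)%:~R * len e.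
    by rewrite rmorphN mulNr -slope; ring.
  by rewrite mulrDl mulfK.
Qed.

(** Since [d] is less than every edge length, raising [S] lowers a rounded slope by at most one, and
    only on edges leaving [S], seen from [S]. *)
Lemma flow_fire (S : {set V}) (d : R) v : (forall e, 0 <= d < len e) ->
  inc src tgt s (fun e => - s e) v - (if v \in S then outdeg src tgt S v else 0) <=
  flow src tgt len (fun u => y u + if u \in S then d else 0) v.
Proof.
move=> hd.
have -> : flow src tgt len (fun u => y u + if u \in S then d else 0) v =
   flow src tgt len (fun u => (if u \in S then d else 0) + y u) v.
  by congr flow; apply: funext => u; rewrite addrC.
rewrite flowD_int addrC lerD2r.
have -> : - (if v \in S then outdeg src tgt S v else 0) =
  inc src tgt (fun e => - (if v \in S then (tgt e \notin S)%:R else 0))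
              (fun e => - (if v \in S then (src e \notin S)%:R else 0)) v.
  case: ifP => vS; first by rewrite incN.
  by rewrite incN /inc !big1 // addr0.
apply: le_inc => e he; rewrite he floor_ge_int; have /andP[d0 dl] := hd e;
  rewrite ler_pdivlMr //; case: (v \in S); case: (_ \in S) => /=;
  rewrite ?subrr ?subr0 ?sub0r ?oppr0 ?mul0r ?mulN1r //; lra.
Qed.

End IntegralSlopes.

(** * Orientation divisors without sections *)

Section Moderator.
Context (R : realType) (V E : finType) (src tgt : E -> V) (len : E -> R).
Hypothesis len_gt0 : forall e, 0 < len e.
Hypothesis loopless : forall e, src e != tgt e.
Context (rho : V -> nat).
Hypothesis rho_inj : injective rho.

Lemma sum_indeg : \sum_v indeg src tgt rho v = #|E|%:Z.
Proof.
have -> : #|E|%:Z = \sum_(e : E) 1 by rewrite sumr_const -mulr_natl mulr1 natz.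
rewrite sum_inc; apply: eq_bigr => e _.
have := loopless e; rewrite -(inj_eq rho_inj).
by case: ltngtP.
Qed.

(** At the vertex of largest [rho] among the maxima of [y], every rounded slope is at most 0, and at
    most -1 towards a later vertex, where [y] is strictly smaller. So the flow there is at most
    [indeg - degree], and -1 remains. *)
Lemma moderator_empty : (0 < #|V|)%N ->
  ~ vertex_nonempty src tgt len (fun v => degree src tgt v - indeg src tgt rho v - 1).
Proof.
move=> /card_gt0P[v0 _] [y hy].
pose m := [arg max_(v > v0) y v]%O.
have hm u : y u <= y m by rewrite /m; case: arg_maxP => // v _ /(_ u); apply.
case: (@arg_maxnP _ m (fun v => y v == y m) rho) => // v /eqP yv hv.
have := hy v => /=; suff : degree src tgt v - indeg src tgt rho v + flow src tgt len y v <= 0 by lra.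
rewrite -incB -incD.
have -> : 0 = inc src tgt (fun=> 0) (fun=> 0) v by rewrite /inc !big1.
have key u l : u != v -> 0 < l ->
    1 - (rho u < rho v)%N%:R + Num.floor ((y u - y v) / l) <= 0.
  move=> uv l0; case: ltngtP => [lt|lt|/rho_inj/eqP]; last by rewrite (negPf uv).
    suff : Num.floor ((y u - y v) / l) <= 0 by move=> ?; lia.
    by rewrite floor_le0 ltr_pdivrMr // yv; have := hm u; lra.
  suff : Num.floor ((y u - y v) / l) < 0 by lia.
  rewrite floor_lt0 ltr_pdivrMr // mul0r yv subr_lt0 lt_neqAle hm andbT.
  by apply: contraL lt => /hv; rewrite -leqNgt.
by apply: le_inc => e he; rewrite he; apply: key => //; have := loopless e; rewrite -he // eq_sym.
Qed.

End Moderator.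

(** * Subdivision of every edge into two *)

Section Bisection.
Context (R : realType) (V E : finType) (src tgt : E -> V) (len c : E -> R).

(** All edges are cut at once, [e] at distance [c e] from its source: [(e, false)] is the part at
    the source, [(e, true)] the part at the target, and [inr e] the cut point. This also removes all
    loops. *)
Definition bsrc (p : E * bool) : V + E := if p.2 then inr p.1 else inl (src p.1).
Definition btgt (p : E * bool) : V + E := if p.2 then inl (tgt p.1) else inr p.1.
Definition blen (p : E * bool) : R := if p.2 then len p.1 - c p.1 else c p.1.

Lemma sum_edge_bool (f : E * bool -> int) :
  \sum_p f p = \sum_e (f (e, true) + f (e, false)).
Proof.
rewrite (eq_bigr (fun p => f (p.1, p.2))) => [|[] //].
by rewrite -(pair_bigA _ (fun e i => f (e, i))) /=; apply: eq_bigr => e _; rewrite big_bool.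
Qed.

Lemma inc_bisect_vertex (a b : E * bool -> int) v :
  inc bsrc btgt a b (inl v) = inc src tgt (fun e => a (e, false)) (fun e => b (e, true)) v.
Proof.
congr (_ + _); rewrite big_mkcond [RHS]big_mkcond sum_edge_bool; apply: eq_bigr => e _;
  by rewrite /= ?add0r ?addr0.
Qed.

Lemma inc_bisect_midpoint (a b : E * bool -> int) e :
  inc bsrc btgt a b (inr e) = a (e, true) + b (e, false).
Proof.
congr (_ + _).
- rewrite (big_pred1 (e, true)) // => -[e' [|]] //=; rewrite xpair_eqE /= ?andbT //.
  by rewrite andbF.
- rewrite (big_pred1 (e, false)) // => -[e' [|]] //=; rewrite xpair_eqE /= ?andbT //.
  by rewrite andbF.
Qed.

Lemma bisect_loopless p : bsrc p != btgt p.
Proof. by case: p => e []. Qed.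

Lemma bisect_connected : (0 < #|V|)%N -> cut_connected src tgt -> cut_connected bsrc btgt.
Proof.
move=> V0 conn S S0 ST; pose T := [set v | inl v \in S].
have [[e he]|] := pselect (exists e, (src e \in T) != (tgt e \in T)).
  move: he; rewrite !inE; case: (boolP (inr e \in S)) => hS he.
    case: (boolP (inl (src e) \in S)) he => hs.
      by case: (boolP (inl (tgt e) \in S)) => ht // _; exists (e, true); rewrite /bsrc /btgt /= hS (negPf ht).
    by move=> _; exists (e, false); rewrite /bsrc /btgt /= hS (negPf hs).
  case: (boolP (inl (src e) \in S)) he => hs.
    by move=> _; exists (e, false); rewrite /bsrc /btgt /= hs (negPf hS).
  by case: (boolP (inl (tgt e) \in S)) => ht // _; exists (e, true); rewrite /bsrc /btgt /= ht (negPf hS).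
move=> hT; have [T0|Tn0] := eqVneq T set0.
  have ns v : inl v \notin S by apply/negP => h; move/setP/(_ v): T0; rewrite !inE h.
  case/set0Pn: S0 => -[v vS|e eS]; first by move: (ns v); rewrite vS.
  by exists (e, false); rewrite /bsrc /btgt /= eS (negPf (ns _)).
have [TT|TnT] := eqVneq T setT; last by case: (conn T Tn0 TnT) => e he; case: hT; exists e.
have ins v : inl v \in S by move/setP/(_ v): TT; rewrite !inE.
have : ~~ [forall x, x \in S] by apply: contra ST => /forallP h; apply/eqP/setP => x; rewrite h inE.
rewrite negb_forall => /existsP[[v|e]]; first by rewrite ins.
by move=> /negPf eS; exists (e, false); rewrite /bsrc /btgt /= eS ins.
Qed.

Hypothesis cut : forall e, 0 < c e < len e.

Lemma blen_gt0 p : 0 < blen p.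
Proof. by case: p => e b; rewrite /blen; have /andP[] := cut e; case: b => /=; lra. Qed.

(** A nonnegative flow at the cut point makes [z] convex along [e], so from either end the slope to
    the cut point is at most the slope of the chord. *)
Lemma flow_bisect (z : V + E -> R) v :
  (forall e, 0 <= flow bsrc btgt blen z (inr e)) ->
  flow bsrc btgt blen z (inl v) <= flow src tgt len (z \o inl) v.
Proof.
rewrite /flow inc_bisect_vertex => hz.
have conv e : [/\ (z (inr e) - z (inl (src e))) / c e <= (z (inl (tgt e)) - z (inl (src e))) / len e &
    (z (inr e) - z (inl (tgt e))) / (len e - c e) <= (z (inl (src e)) - z (inl (tgt e))) / len e].
  have /andP[c0 cl] := cut e; have l0 : 0 < len e - c e by lra.
  have := hz e; rewrite inc_bisect_midpoint /bsrc /btgt /blen /=.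
  set A := Num.floor _; set B := Num.floor _ => AB.
  have hA : A%:~R * (len e - c e) <= z (inl (tgt e)) - z (inr e) by rewrite -ler_pdivlMr ?floor_le.
  have hB : B%:~R * c e <= z (inl (src e)) - z (inr e) by rewrite -ler_pdivlMr ?floor_le.
  have hAB : 0 <= A%:~R + B%:~R :> R by rewrite -rmorphD ler0z.
  have key : (z (inr e) - z (inl (src e))) * (len e - c e) <= (z (inl (tgt e)) - z (inr e)) * c e.
    have := ler_wpM2r (ltW c0) hA; have := ler_wpM2r (ltW l0) hB.
    have := mulr_ge0 hAB (mulr_ge0 (ltW c0) (ltW l0)); lra.
  by split; rewrite ler_pdivrMr // mulrAC ler_pdivlMr //; lra.
by apply: le_inc => e _; rewrite /bsrc /btgt /blen /=; apply: le_floor; have [] := conv e.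
Qed.

End Bisection.

(** The two rounded-down outgoing slopes are the floor of the mean slope and minus its ceiling.
    Following the floor up to [c] and the ceiling afterwards realizes both. *)
Lemma breakpoint (R : realType) (l y0 y1 : R) : 0 < l ->
  exists t : R * int * int, let: (c, s1, s2) := t in
  [/\ 0 < c < l, y1 = y0 + s1%:~R * c + s2%:~R * (l - c),
      s1 = Num.floor ((y1 - y0) / l), - s2 = Num.floor ((y0 - y1) / l) &
      s1 <= s2 <= s1 + 1].
Proof.
move=> l0; pose x := (y1 - y0) / l; have y1E : y1 = y0 + x * l by rewrite divfK ?gt_eqF //; lra.
have -> : (y0 - y1) / l = - x by rewrite -mulNr opprB.
rewrite -/x; clearbody x; subst y1.
have [xint|xnint] := boolP (x \is a Num.int).
  (* An integral mean slope needs no bend; any interior point serves as [c]. *)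
  exists (l / 2, Num.floor x, Num.floor x); rewrite floorN // floorK //.
  by split=> //; lra.
have hx := floor_itv x; move: (xnint); rewrite intrEfloor => nx.
have {nx} : (Num.floor x)%:~R < x by rewrite lt_neqAle nx floor_le.
move: hx; set n := Num.floor x; rewrite rmorphD /= => /andP[h1 h2] h3.
(* The solution [c] of [n * c + (n + 1) * (l - c) = x * l]. *)
exists (l * (n%:~R + 1 - x), n, n + 1); split=> //.
- apply/andP; split; first by rewrite mulr_gt0 //; lra.
  by rewrite gtr_pMr //; lra.
- by rewrite rmorphD /=; ring.
- symmetry; apply: floor_def; rewrite !rmorphD !rmorphN /= ?rmorphD /=; lra.
- lia.
Qed.

(** * Reduced divisors and the complement of a vertex divisor *)

Section VertexModerator.
Context (R : realType) (V E : finType) (src tgt : E -> V) (len : E -> R).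
Hypothesis len_gt0 : forall e, 0 < len e.
Hypothesis V_gt0 : (0 < #|V|)%N.
Hypothesis conn : cut_connected src tgt.

Definition extend0 (F : V -> int) (v : V + E) : int := if v is inl u then F u else 0.

Lemma vertex_moderator (F : V -> int) : ~ vertex_nonempty src tgt len F ->
  exists (c : E -> R) (G : V + E -> int),
  [/\ forall e, 0 < c e < len e, forall v, 0 <= G v,
      \sum_v G v = #|E|%:Z - #|V|%:Z - \sum_v F v &
      ~ vertex_nonempty (bsrc src) (btgt tgt) (blen len c)
          (fun v => degree (bsrc src) (btgt tgt) v - 2 - extend0 F v - G v)].
Proof.
move=> Fempty; have /card_gt0P[q _] := V_gt0.
have [y [yq hy] ymax] := exists_max_admissible len_gt0 F q conn.
have /choice[t ht] := fun e => breakpoint (y (src e)) (y (tgt e)) (len_gt0 e).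
pose c e := (t e).1.1; pose s (p : E * bool) := if p.2 then (t p.1).2 else (t p.1).1.2.
have {ht} ht e : [/\ 0 < c e < len e,
    y (tgt e) = y (src e) + (s (e, false))%:~R * c e + (s (e, true))%:~R * (len e - c e),
    s (e, false) = Num.floor ((y (tgt e) - y (src e)) / len e),
    - s (e, true) = Num.floor ((y (src e) - y (tgt e)) / len e) &
    s (e, false) <= s (e, true) <= s (e, false) + 1].
  by have := ht e; rewrite /c /s /=; case: (t e) => -[].
have cut e : 0 < c e < len e by have [] := ht e.
have bl0 := blen_gt0 cut.
(* [z] extends [y] to the breakpoints and has integral slopes [s]. Hence [F'] below is the reduced
   divisor on the subdivision, with at most one chip at each cut point. *)
pose z (v : V + E) := match v with inl u => y u | inr e => y (src e) + (s (e, false))%:~R * c e end.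
have slope p : z (btgt tgt p) - z (bsrc src p) = (s p)%:~R * blen len c p.
  case: p => e []; rewrite /z /btgt /bsrc /blen /=; last by ring.
  by have [_ -> _ _ _] := ht e; ring.
pose dz : V + E -> int := inc (bsrc src) (btgt tgt) s (fun p => - s p).
pose F' v : int := extend0 F v + dz v.
have F'l v : F' (inl v) = F v + flow src tgt len y v.
  rewrite /F' /dz inc_bisect_vertex; congr (_ + _); apply: eq_inc => e _; by have [] := ht e.
have F'r e : 0 <= F' (inr e) <= 1.
  by rewrite /F' /dz inc_bisect_midpoint /= add0r; have [_ _ _ _] := ht e; lia.
have F'q : F' (inl q) < 0.
  rewrite ltNge; apply/negP => hq; apply: Fempty; exists y => v; rewrite -F'l.
  by have [->//|vq] := eqVneq v q; rewrite F'l hy.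
have F'ge0 v : v != inl q -> 0 <= F' v.
  by case: v => [v|e] vq; [rewrite F'l hy|case/andP: (F'r e)].
have [[S [S0 qS hS]]|[rho [rinj rq hrho]]] := dhar_burning (bsrc src) (btgt tgt) F' (inl q).
  (* The fire has stopped. Raising [S] by less than every edge length of the subdivision keeps [z']
     good away from [q], so maximality of [y] keeps all old vertices out of [S]. A cut point in [S]
     would then have outdegree 2, but it carries at most one chip. *)
  have [d d0 hd] : exists2 d : R, 0 < d & forall p h, h < d -> h < blen len c p.
    by apply: uniform_radius => p; exists (blen len c p).
  pose z' u := z u + if u \in S then d / 2 else 0.
  have fire v : v != inl q -> 0 <= extend0 F v + flow (bsrc src) (btgt tgt) (blen len c) z' v.
    move=> vq; have d2 p : 0 <= d / 2 < blen len c p by apply/andP; split; [lra|apply: hd; lra].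
    have hf := flow_fire bl0 slope S v d2; rewrite -/z' -/(dz v) in hf.
    have := F'ge0 v vq; move: hf (hS v); rewrite /F'; case: (v \in S) => hf => [/(_ isT)|_];
      move: (dz v) (extend0 F v) (flow _ _ _ z' v) hf => X Y W; lia.
  have nS v : inl v \notin S.
    have hz' : admissible src tgt len F q (z' \o inl).
      split=> [|u uq]; first by rewrite /z' /= (negPf qS) addr0.
      apply: le_trans (fire (inl u) uq) _; rewrite lerD2l.
      by apply: flow_bisect => // e; have := fire (inr e) isT; rewrite add0r.
    have := ymax _ hz' v; rewrite /z' /=; case: (inl v \in S) => //; lra.
  case/set0Pn: S0 => -[v vS|e /hS]; first by case/negP: (nS v).
  rewrite /outdeg inc_bisect_midpoint /bsrc /btgt /= !nS.
  by have := F'r e; lia.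
(* Everything has burnt, so [indeg - 1 - F'] is nonnegative away from [q]; at [q] this holds because
   [F'] is negative there. *)
exists c, (fun v => indeg (bsrc src) (btgt tgt) rho v - 1 - F' v); split=> //.
- move=> v /=; have [->|/hrho] := eqVneq v (inl q); last by lia.
  have I0 : 0 <= indeg (bsrc src) (btgt tgt) rho (inl q) by apply: addr_ge0; apply: sumr_ge0.
  by move: (F' (inl q)) F'q (indeg _ _ _ _) I0 => B hB A hA; lia.
- rewrite big_split big_split /= sum_indeg //; last exact: bisect_loopless.
  rewrite !sumrN big_split /= sum_inc [X in _ - (_ + X)]big1 => [|p _]; last lra.
  rewrite sumr_const -mulr_natl mulr1 natz card_sum card_prod card_bool big_sumType /=.
  rewrite [X in _ - (_ + X + _)]big1 //; rewrite PoszM PoszD; lra.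
- case=> u hu.
  have V'_gt0 : (0 < #|{: V + E}|)%N by rewrite card_sum; lia.
  apply: (moderator_empty bl0 (bisect_loopless src tgt) rinj V'_gt0).
  (* Adding [z] undoes the passage from [F] to [F']: a section of the complement becomes one of the
     divisor excluded by [moderator_empty]. *)
  exists (fun v => u v + z v) => v; rewrite (flowD_int bl0 slope) -/(dz v).
  by have := hu v; rewrite /F' /=; lra.
Qed.

End VertexModerator.

(** * Piecewise affine functions on edges and subdivision *)

Section EdgeSection.
Context (R : realType).
Implicit Types (d : R -> int) (x z t y : R) (a b s : int).

(* [edge_section d x z y0 y1 a b]: on [x, z] there is a piecewise affine function
   with values y0, y1 and outgoing slopes a, b at the ends whose divisor plus d is
   nonnegative on the interior. *)
Inductive edge_section d : R -> R -> R -> R -> int -> int -> Prop :=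
| edge_section_affine x z y0 y1 s b : x < z -> (forall t, x < t < z -> 0 <= d t) ->
    y1 = y0 + s%:~R * (z - x) -> b = - s -> edge_section d x z y0 y1 s b
| edge_section_cat x m z y0 y1 y2 a b a' b' :
    edge_section d x m y0 y1 a b -> edge_section d m z y1 y2 a' b' ->
    0 <= d m + (b + a') -> edge_section d x z y0 y2 a b'.

Lemma edge_section_lt d x z y0 y1 a b : edge_section d x z y0 y1 a b -> x < z.
Proof. by elim=> // *; lra. Qed.

Lemma edge_section_split d x z y0 y2 a b : edge_section d x z y0 y2 a b ->
  forall c, x < c < z -> exists t : R * int * int,
  [/\ edge_section d x c y0 t.1.1 a t.1.2, edge_section d c z t.1.1 y2 t.2 b &
      0 <= d c + (t.1.2 + t.2)].
Proof.
elim=> {x z y0 y2 a b} [x z y0 y1 s b xz hd -> -> c /andP[xc cz]|].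
  exists (y0 + s%:~R * (c - x), - s, s); split=> /=.
  - by apply: edge_section_affine => // t ht; apply: hd; lra.
  - by apply: edge_section_affine => // [t ht|]; [apply: hd; lra|ring].
  - by rewrite addNr addr0 hd // xc.
move=> x m z y0 y1 y2 a b a' b' h1 IH1 h2 IH2 hm c /andP[xc cz].
have xm := edge_section_lt h1; have mz := edge_section_lt h2.
case: (ltgtP c m) => [cm|mc|->]; last by exists (y1, b, a').
- have [|t [h3 h4 h5]] := IH1 c; first by rewrite xc.
  by exists t; split=> //; apply: (edge_section_cat h4 h2 hm).
- have [|t [h3 h4 h5]] := IH2 c; first by rewrite mc.
  by exists t; split=> //; apply: (edge_section_cat h1 h3 hm).
Qed.

(** Where [d] is nonpositive the function is convex, so its outgoing slope at either end is at most
    that of the chord. *)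
Lemma edge_section_slopes d x z y0 y1 a b : edge_section d x z y0 y1 a b ->
  (forall t, x < t < z -> d t <= 0) ->
  a%:~R * (z - x) <= y1 - y0 /\ b%:~R * (z - x) <= y0 - y1.
Proof.
elim=> {x z y0 y1 a b} [x z y0 y1 s b xz _ -> -> _|]; first by rewrite rmorphN /=; lra.
move=> x m z y0 y1 y2 a b a' b' h1 IH1 h2 IH2 hm hd.
have xm := edge_section_lt h1; have mz := edge_section_lt h2.
have [|ha hb] := IH1 _; first by move=> t ht; apply: hd; lra.
have [|ha' hb'] := IH2 _; first by move=> t ht; apply: hd; lra.
have dm : d m <= 0 by apply: hd; rewrite xm.
have ba : 0 <= b%:~R + a'%:~R :> R by rewrite -rmorphD ler0z; lia.
have l1 : 0 < m - x by lra.
have l2 : 0 < z - m by lra.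
(* Adding the two bounds on each piece yields [a <= - b <= a' <= - b']: slopes increase from [x] to
   [z]. *)
have ab : a%:~R + b%:~R <= 0 :> R by rewrite -(pmulr_lle0 _ l1); lra.
have ab' : a'%:~R + b'%:~R <= 0 :> R by rewrite -(pmulr_lle0 _ l2); lra.
by split; nra.
Qed.

(** Scaling lengths and values by the same [k] keeps all slopes. With [k = 1] this moves coordinates
    under subdivision; general [k] rescales the loops. *)
Lemma edge_section_image d d' (k h w : R) x z y0 y1 a b : 0 < k ->
  edge_section d x z y0 y1 a b -> (forall t, x < t < z -> d t <= d' (k * t + h)) ->
  edge_section d' (k * x + h) (k * z + h) (k * y0 + w) (k * y1 + w) a b.
Proof.
move=> k0; elim=> {x z y0 y1 a b} [x z y0 y1 s b xz hd -> -> hdd|].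
  apply: edge_section_affine => // [|t /andP[ht1 ht2]|]; [|  |ring].
  - by rewrite ltrD2r ltr_pM2l.
  - have -> : t = k * ((t - h) / k) + h by rewrite mulrC divfK ?gt_eqF //; lra.
    have ht : x < (t - h) / k < z.
      by rewrite ltr_pdivlMr // ltr_pdivrMr //; lra.
    by apply: le_trans (hdd _ ht); apply: hd.
move=> x m z y0 y1 y2 a b a' b' h1 IH1 h2 IH2 hm hd.
have xm := edge_section_lt h1; have mz := edge_section_lt h2.
apply: (@edge_section_cat _ _ (k * m + h) _ _ (k * y1 + w) _ _ b a').
- by apply: IH1 => t ht; apply: hd; lra.
- by apply: IH2 => t ht; apply: hd; lra.
- have : d m <= d' (k * m + h) by apply: hd; rewrite xm.
  by move: hm; set A := d m; set B := d' _; lia.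
Qed.

Lemma edge_section_translate d d' (h : R) x z x' z' y0 y1 a b :
  edge_section d x z y0 y1 a b -> x' = x + h -> z' = z + h ->
  (forall t, x < t < z -> d t <= d' (t + h)) -> edge_section d' x' z' y0 y1 a b.
Proof.
move=> hs -> -> hd; have := @edge_section_image d d' 1 h 0 x z y0 y1 a b ltr01 hs.
by rewrite !mul1r !addr0; apply=> t; rewrite mul1r; apply: hd.
Qed.

End EdgeSection.

(** * Sections on a metric graph and their behaviour under subdivision *)

Section MetricGraph.
Context (R : realType) (V E : finType) (src tgt : E -> V) (len : E -> R).
Implicit Types D : pt R V E -> int.

(** A form of [RD_nonempty] that keeps only vertex values and end slopes, the rest being in
    [edge_section]. [D] is a bare function on points, so that it transports by composition with maps
    of points. *)
Definition metric_nonempty D : Prop := exists (y : V -> R) (a b : E -> int),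
  (forall e, edge_section (fun t => D (inr (e, t))) 0 (len e) (y (src e)) (y (tgt e)) (a e) (b e)) /\
  forall v, 0 <= D (inl v) + inc src tgt a b v.

Lemma metric_nonempty_mono D D' : (forall p, valid_pt len p -> D p <= D' p) ->
  metric_nonempty D -> metric_nonempty D'.
Proof.
move=> hD [y [a [b [hs hv]]]]; exists y, a, b; split=> [e|v].
  apply: (edge_section_translate (h := 0) (hs e)); rewrite ?addr0 // => t ht.
  by rewrite addr0; apply: hD.
by apply: le_trans (hv v) _; rewrite lerD2r hD.
Qed.

Hypothesis len_gt0 : forall e, 0 < len e.

(** With no chips inside the edges, [edge_section_slopes] bounds the integral end slopes by the
    floors of the chord slopes; conversely [breakpoint] attains both floors at once. *)
Lemma metric_nonempty_vertex D : (forall e t, 0 < t < len e -> D (inr (e, t)) = 0) ->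
  metric_nonempty D <-> vertex_nonempty src tgt len (fun v => D (inl v)).
Proof.
move=> hD; split=> [[y [a [b [hs hv]]]]|[y hy]].
  exists y => v; apply: le_trans (hv v) _; rewrite lerD2l.
  have hD0 e t : 0 < t < len e -> D (inr (e, t)) <= 0 by move=> /hD ->.
  have sl e := edge_section_slopes (hs e) (hD0 e).
  apply: le_inc => e _; rewrite floor_ge_int ler_pdivlMr //; have := sl e; rewrite subr0; lra.
have /choice[t ht] := fun e => breakpoint (y (src e)) (y (tgt e)) (len_gt0 e).
exists y, (fun e => (t e).1.2), (fun e => - (t e).2); split=> [e|v].
  have := ht e; case: (t e) => -[c s1] s2 [/andP[c0 cl] -> _ _ /andP[s12 _]] /=.
  apply: (@edge_section_cat _ _ _ c _ _ (y (src e) + s1%:~R * c) _ _ (- s1) s2).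
  - by apply: edge_section_affine; rewrite ?subr0 // => u hu; rewrite hD //; lra.
  - by apply: edge_section_affine => // u hu; rewrite hD //; lra.
  - by rewrite hD ?c0 // add0r; lia.
apply: le_trans (hy v) _; rewrite lerD2l.
by apply: le_inc => e _; have := ht e; case: (t e) => -[c s1] s2 [] _ _ h1 h2 _ /=; rewrite ?h1 ?h2.
Qed.

Context (c : E -> R).
Hypothesis cut : forall e, 0 < c e < len e.

Definition bisect_pt (p : pt R V E) : pt R (V + E)%type (E * bool)%type :=
  match p with
  | inl v => inl (inl v)
  | inr (e, t) => if t == c e then inl (inr e)
                  else if t < c e then inr ((e, false), t) else inr ((e, true), t - c e)
  end.

Definition unbisect_pt (p : pt R (V + E)%type (E * bool)%type) : pt R V E :=
  match p with
  | inl (inl v) => inl v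
  | inl (inr e) => inr (e, c e)
  | inr ((e, b), t) => inr (e, if b then t + c e else t)
  end.

Lemma bisect_pt_valid p : valid_pt len p -> valid_pt (blen len c) (bisect_pt p).
Proof.
case: p => [//|[e t]] /= /andP[t0 tl]; case: ltgtP => //= ct; rewrite /blen /=; lra.
Qed.

Lemma unbisect_pt_valid p : valid_pt (blen len c) p -> valid_pt len (unbisect_pt p).
Proof. by case: p => [[|]|[[e []] t]] //=; rewrite /blen /=; have := cut e; lra. Qed.

Lemma bisect_ptK p : unbisect_pt (bisect_pt p) = p.
Proof. by case: p => [|[e t]] //=; case: ltgtP => //= [_|->]; rewrite ?subrK. Qed.

Lemma unbisect_ptK p : valid_pt (blen len c) p -> bisect_pt (unbisect_pt p) = p.
Proof.
case: p => [[|e]|[[e []] t]] //=; rewrite /blen /= ?eqxx // => /andP[t0 tl].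
- rewrite -{2}[c e]add0r -{4}[c e]add0r (inj_eq (addIr _)) ltrD2r gt_eqF // ltNge ltW //=.
  by rewrite addrK.
- by rewrite lt_eqF // tl.
Qed.

End MetricGraph.

(** The vertex condition at a cut point is exactly the joint condition of [edge_section_cat], so
    sections are split and glued edge by edge. *)
Lemma metric_nonempty_bisect (R : realType) (V E : finType) (src tgt : E -> V)
    (len c : E -> R) (D : pt R V E -> int) : (forall e, 0 < c e < len e) ->
  metric_nonempty src tgt len D <->
  metric_nonempty (bsrc src) (btgt tgt) (blen len c) (D \o unbisect_pt c).
Proof.
move=> cut; split=> [[y [a [b [hs hv]]]]|[y [a [b [hs hv]]]]].
  have /choice[t ht] := fun e => edge_section_split (hs e) (cut e).
  exists (fun v => match v with inl u => y u | inr e => (t e).1.1 end),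
    (fun p => if p.2 then (t p.1).2 else a p.1), (fun p => if p.2 then b p.1 else (t p.1).1.2).
  split=> [[e []]|[v|e]] /=; rewrite /bsrc /btgt /blen /=; last 2 first.
  - by rewrite inc_bisect_vertex.
  - by rewrite inc_bisect_midpoint /= [(t e).2 + _]addrC; have [] := ht e.
  - have [_ h2 _] := ht e.
    by apply: (edge_section_translate (h := - c e) h2); rewrite ?subrr // => u _; rewrite subrK.
  - have [h1 _ _] := ht e.
    by apply: (edge_section_translate (h := 0) h1); rewrite ?addr0 // => u _; rewrite addr0.
exists (y \o inl), (fun e => a (e, false)), (fun e => b (e, true)); split=> [e|v]; last first.
  by have := hv (inl v); rewrite inc_bisect_vertex.
apply: (@edge_section_cat _ _ _ (c e) _ _ (y (inr e)) _ _ (b (e, false)) (a (e, true))).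
- exact: (hs (e, false)).
- apply: (edge_section_translate (h := c e) (hs (e, true))); rewrite ?add0r //.
  by rewrite /blen /= subrK.
- by have := hv (inr e); rewrite inc_bisect_midpoint /= [a _ + _]addrC.
Qed.

(** * Divisors as lists *)

Section Divisors.
Context (R : realType) (V E : finType) (len : E -> R).
Implicit Types (D : divisor R V E) (p : pt R V E).

Lemma coef_invalid D p : is_div len D -> ~~ valid_pt len p -> coef D p = 0.
Proof.
move=> /allP hD hp; rewrite /coef big_seq_cond big1 // => q /andP[qD /eqP qp].
by have := hD q qD; rewrite /= qp (negPf hp).
Qed.

Lemma coef_nonneg D p : all (fun q => 0 <= q.2) D -> 0 <= coef D p.
Proof.
by move=> /allP hD; rewrite /coef big_seq_cond; apply: sumr_ge0 => q /andP[/hD].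
Qed.

(** A list may repeat points, so its entries are regrouped over a duplicate-free list that covers
    them. *)
Lemma deg_coef D (s : seq (pt R V E)) : uniq s -> {subset [seq q.1 | q <- D] <= s} ->
  deg D = \sum_(p <- s) coef D p.
Proof.
move=> us hs; rewrite /coef (exchange_big_dep xpredT) //= /deg big_seq [RHS]big_seq.
apply: eq_bigr => q qD; have qs : q.1 \in s by apply/hs/map_f.
rewrite big_mkcond (bigD1_seq q.1) //= eqxx big1 ?addr0 // => p.
by rewrite eq_sym => /negPf ->.
Qed.

Lemma deg_effective D : effective D -> 0 <= deg D.
Proof.
move=> hD; rewrite (@deg_coef _ (undup [seq q.1 | q <- D])) ?undup_uniq //.
  by apply: sumr_ge0.
by move=> p; rewrite mem_undup.
Qed.

Lemma coef_sub D D' p : coef (div_sub D D') p = coef D p - coef D' p.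
Proof. by rewrite /coef /div_sub big_cat big_map sumrN. Qed.

Lemma deg_sub D D' : deg (div_sub D D') = deg D - deg D'.
Proof. by rewrite /deg /div_sub big_cat big_map sumrN. Qed.

Lemma is_div_sub D D' : is_div len D -> is_div len D' -> is_div len (div_sub D D').
Proof. by move=> hD hD'; rewrite /is_div all_cat all_map; apply/andP. Qed.

Definition vertex_div (G : V -> int) : divisor R V E := [seq (inl v, G v) | v <- enum V].

Lemma coef_vertex_div G v : coef (vertex_div G) (inl v) = G v.
Proof.
rewrite /coef big_map (eq_bigl (pred1 v)) => [|u]; last by rewrite /= eqE.
by rewrite big_enum_cond big_pred1_eq.
Qed.

Lemma coef_vertex_div_edge G x : coef (vertex_div G) (inr x) = 0.
Proof. by rewrite /coef big_map big_pred0. Qed.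

Lemma deg_vertex_div G : deg (vertex_div G) = \sum_v G v.
Proof. by rewrite /deg big_map big_enum. Qed.

End Divisors.

Section PushForward.
Context (R : realType) (V E V' E' : finType) (f : pt R V E -> pt R V' E').

Definition push (D : divisor R V E) : divisor R V' E' := [seq (f q.1, q.2) | q <- D].

Lemma deg_push D : deg (push D) = deg D.
Proof. by rewrite /deg big_map. Qed.

Lemma is_div_push len len' D : (forall p, valid_pt len p -> valid_pt len' (f p)) ->
  is_div len D -> is_div len' (push D).
Proof. by move=> hf /allP hD; rewrite /is_div all_map; apply/allP => q /hD; apply: hf. Qed.

Lemma coef_push len (g : pt R V' E' -> pt R V E) D p : is_div len D ->
  (forall q, valid_pt len q -> g (f q) = q) -> f (g p) = p ->
  coef (push D) p = coef D (g p).
Proof.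
move=> /allP hD gf fg; rewrite /coef big_map big_seq_cond [RHS]big_seq_cond.
apply: eq_bigl => q /=; case: (boolP (q \in D)) => //= /hD /gf gfq.
by apply/eqP/eqP => [<-|->].
Qed.

End PushForward.

Definition canonical_coef (R : realType) (V E : finType) (src tgt : E -> V) (p : pt R V E) : int :=
  if p is inl v then degree src tgt v - 2 else 0.

(** A cut point has degree 2, hence canonical coefficient 0. *)
Lemma canonical_bisect (R : realType) (V E : finType) (src tgt : E -> V) (c : E -> R) p :
  canonical_coef src tgt (unbisect_pt c p) = canonical_coef (bsrc src) (btgt tgt) p.
Proof.
case: p => [[v|e]|[[e []] t]] //=; first by rewrite /degree inc_bisect_vertex.
by rewrite /degree inc_bisect_midpoint.
Qed.

Definition on_edge (R : realType) (V E : finType) (p : pt R V E) : bool :=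
  if p is inr _ then true else false.

(** Induction on the number of entries of [D] inside edges, reducing subdivision-invariant
    statements to divisors on vertices. [P] ranges over all graphs because each step changes the
    graph. *)
Lemma subdivision_ind (R : realType)
    (P : forall V E : finType, (E -> V) -> (E -> V) -> (E -> R) -> divisor R V E -> Prop) :
  (forall (V E : finType) (src tgt : E -> V) (len : E -> R) D,
     (0 < #|V|)%N -> cut_connected src tgt -> (forall e, 0 < len e) -> is_div len D ->
     all (fun q => ~~ on_edge q.1) D -> P V E src tgt len D) ->
  (forall (V E : finType) (src tgt : E -> V) (len c : E -> R) D,
     (forall e, 0 < c e < len e) -> is_div len D ->
     P _ _ (bsrc src) (btgt tgt) (blen len c) (push (bisect_pt c) D) ->
     P V E src tgt len D) ->
  forall (V E : finType) (src tgt : E -> V) (len : E -> R) D,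
     (0 < #|V|)%N -> cut_connected src tgt -> (forall e, 0 < len e) -> is_div len D ->
     P V E src tgt len D.
Proof.
move=> base step V E src tgt len D.
have [n] := ubnP (count (fun q => on_edge q.1) D).
elim: n V E src tgt len D => // n IH V E src tgt len D hn V0 conn len0 hD.
have [hall|] := boolP (all (fun q => ~~ on_edge q.1) D); first exact: base.
case/allPn => -[[//|[e0 t0]] k] qD _; have /= t0l := allP hD _ qD.
(* The cut of [e0] passes through the chosen entry, which becomes a vertex; all other edges are
   halved. *)
pose c e := if e == e0 then t0 else len e / 2.
have cut e : 0 < c e < len e.
  by rewrite /c; case: eqP => [->//|_]; have := len0 e; lra.
apply: (step _ _ _ _ _ c) => //; apply: IH => //.
- suff : (count (fun q => on_edge q.1) (push (bisect_pt c) D) < count (fun q => on_edge q.1) D)%N by move/leq_trans; apply; rewrite -ltnS.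
  have sub (s : divisor R V E) : (count (fun q => on_edge q.1) (push (bisect_pt c) s) <=
      count (fun q => on_edge q.1) s)%N.
    by rewrite count_map; apply: sub_count => -[[//|[e t]] i] _.
  case/splitPr: qD => s1 s2; rewrite /push map_cat !count_cat /= {2}/c !eqxx /=.
  by have := sub s1; have := sub s2; rewrite /push; lia.
- by rewrite card_sum; lia.
- exact: bisect_connected.
- exact: blen_gt0.
- by apply: is_div_push hD => p; apply: bisect_pt_valid.
Qed.

Lemma coef_push_bisect (R : realType) (V E : finType) (len c : E -> R) (D : divisor R V E) p :
  (forall e, 0 < c e < len e) -> is_div len D -> valid_pt (blen len c) p ->
  coef (push (bisect_pt c) D) p = coef D (unbisect_pt c p).
Proof.
by move=> cut hD hp; apply: (coef_push hD) => [q _|]; [exact: bisect_ptK|exact: unbisect_ptK hp].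
Qed.

Lemma coef_push_unbisect (R : realType) (V E : finType) (len c : E -> R)
    (D : divisor R (V + E)%type (E * bool)%type) p :
  (forall e, 0 < c e < len e) -> is_div (blen len c) D -> valid_pt (blen len c) p ->
  coef (push (unbisect_pt c) D) (unbisect_pt c p) = coef D p.
Proof.
move=> cut hD hp; have K (q : pt R (V + E)%type (E * bool)%type) :
  valid_pt (blen len c) q -> bisect_pt c (unbisect_pt c q) = q by apply: unbisect_ptK.
by rewrite (coef_push (g := bisect_pt c) hD) => [|//|]; rewrite (K p hp).
Qed.

Lemma coef_vertex_supported (R : realType) (V E : finType) (D : divisor R V E) x :
  all (fun q => ~~ on_edge q.1) D -> coef D (inr x) = 0.
Proof.
move=> /allP hD; rewrite /coef big_seq_cond big1 // => q /andP[/hD hq /eqP qx].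
by rewrite qx in hq.
Qed.

Lemma deg_vertex_supported (R : realType) (V E : finType) (D : divisor R V E) :
  all (fun q => ~~ on_edge q.1) D -> deg D = \sum_v coef D (inl v).
Proof.
move=> /allP hD; rewrite (@deg_coef _ _ _ _ [seq inl v | v <- enum V]).
- by rewrite big_map big_enum.
- by rewrite map_inj_uniq ?enum_uniq // => u v [].
- move=> p /mapP[[[v|x] k] /hD // _ ->]; apply/mapP; exists v => //; exact: mem_enum.
Qed.

(** * Degrees and complementary divisors on metric graphs *)

Section Main.
Context (R : realType) (V E : finType) (src tgt : E -> V) (len : E -> R).
Hypothesis V_gt0 : (0 < #|V|)%N.
Hypothesis conn : cut_connected src tgt.
Hypothesis len_gt0 : forall e, 0 < len e.

Lemma metric_nonempty_deg (D : divisor R V E) : is_div len D ->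
  metric_nonempty src tgt len (coef D) -> 0 <= deg D.
Proof.
move=> hD; apply: (subdivision_ind (P := fun V E src tgt len D =>
  metric_nonempty src tgt len (coef D) -> 0 <= deg D)) hD => //.
- move=> V' E' s t l F _ _ l0 _ hF; rewrite metric_nonempty_vertex => // [|e u _].
    by move/vertex_nonempty_sum; rewrite deg_vertex_supported.
  exact: coef_vertex_supported.
- move=> V' E' s t l c F cut hF; rewrite deg_push => IH hne; apply: IH.
  move: hne; rewrite (metric_nonempty_bisect _ _ _ cut).
  by apply: metric_nonempty_mono => p hp; rewrite (coef_push_bisect cut hF hp).
Qed.

(** [vertex_moderator] settles divisors on vertices. Subdivision preserves [#|E| - #|V|], the
    canonical divisor and the existence of sections, so the general case follows. *)
Lemma complementary_divisor (F : divisor R V E) : is_div len F ->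
  ~ metric_nonempty src tgt len (coef F) ->
  exists G : divisor R V E, [/\ is_div len G, all (fun q => 0 <= q.2) G,
    deg G = #|E|%:Z - #|V|%:Z - deg F &
    ~ metric_nonempty src tgt len (fun p => canonical_coef src tgt p - coef F p - coef G p)].
Proof.
move=> hF; apply: (subdivision_ind (P := fun V E src tgt len F =>
  ~ metric_nonempty src tgt len (coef F) ->
  exists G : divisor R V E, [/\ is_div len G, all (fun q => 0 <= q.2) G,
    deg G = #|E|%:Z - #|V|%:Z - deg F &
    ~ metric_nonempty src tgt len (fun p => canonical_coef src tgt p - coef F p - coef G p)])) hF => //.
- move=> {F} V' E' s t l F V0 co l0 hF hFv.
  rewrite metric_nonempty_vertex => // [|e u _]; last exact: coef_vertex_supported.
  case/(vertex_moderator l0 V0 co) => c [G [cut G0 Gdeg Gempty]].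
  have hG : is_div (blen l c) (vertex_div R (E' * bool)%type G).
    by apply/allP => q /mapP[v _ ->].
  (* [G] lives on the subdivision at the breakpoints, so its image may have points inside the
     original edges. *)
  exists (push (unbisect_pt c) (vertex_div R (E' * bool)%type G)); split.
  + by apply: is_div_push hG => p; apply: unbisect_pt_valid.
  + by rewrite all_map; apply/allP => q /mapP[v _ ->] /=.
  + by rewrite deg_push deg_vertex_div Gdeg deg_vertex_supported.
  + rewrite (metric_nonempty_bisect _ _ _ cut) => hne; apply: Gempty.
    have coefG p : valid_pt (blen l c) p -> coef (push (unbisect_pt c)
        (vertex_div R (E' * bool)%type G)) (unbisect_pt c p) = coef (vertex_div R (E' * bool)%type G) p.
      exact: coef_push_unbisect.
    have bl0 := blen_gt0 cut.
    pose D' (p : pt R (V' + E')%type (E' * bool)%type) : int :=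
      if p is inl v then degree (bsrc s) (btgt t) v - 2 - extend0 (fun v => coef F (inl v)) v - G v else 0.
    have : metric_nonempty (bsrc s) (btgt t) (blen l c) D'.
      apply: metric_nonempty_mono hne => p hp /=; rewrite canonical_bisect coefG //.
      case: p hp => [v|[[e b] u]] hp; last first.
        by rewrite /= coef_vertex_div_edge coef_vertex_supported.
      rewrite coef_vertex_div /=; case: v hp => [v|e] _ //=.
      by rewrite coef_vertex_supported.
    by rewrite metric_nonempty_vertex.
- move=> {F} V' E' s t l c F cut hF IH hne; have [|G' [hG' G'0 G'deg G'e]] := IH.
    apply: contra_not hne; rewrite [X in _ -> X](metric_nonempty_bisect _ _ _ cut).
    by apply: metric_nonempty_mono => p hp; rewrite (coef_push_bisect cut hF hp).
  exists (push (unbisect_pt c) G'); split.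
  + by apply: is_div_push hG' => p; apply: unbisect_pt_valid.
  + by rewrite all_map.
  + by rewrite deg_push G'deg deg_push card_sum card_prod card_bool; lia.
  + apply: contra_not G'e; rewrite (metric_nonempty_bisect _ _ _ cut).
    apply: metric_nonempty_mono => p hp /=.
    by rewrite canonical_bisect (coef_push_bisect cut hF hp) (coef_push_unbisect cut hG' hp).
Qed.

End Main.

(** * Comparison with [RD_nonempty] *)

Section PiecewiseAffine.
Context (R : realType).
Implicit Types (phi psi : R -> R) (d : R -> int) (x z t y dir : R) (a b s : int).

Lemma out_slope_unique phi t dir s s' :
  out_slope phi t dir s -> out_slope phi t dir s' -> s = s'.
Proof.
move=> [d d0 hd] [d' d'0 hd']; pose h := Num.min d d' / 2.
have m0 : 0 < Num.min d d' by rewrite lt_min d0.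
have m1 : Num.min d d' <= d by rewrite ge_min lexx.
have m2 : Num.min d d' <= d' by rewrite ge_min lexx orbT.
have h0 : 0 < h by rewrite /h; lra.
have /hd e1 : 0 < h < d by rewrite h0 /h; lra.
have /hd' e2 : 0 < h < d' by rewrite h0 /h; lra.
have : s%:~R * h = s'%:~R * h by lra.
by move/(mulIf (lt0r_neq0 h0))/intr_inj.
Qed.

Lemma out_slope_affine phi x z s t dir : x < z ->
  (forall u, x <= u <= z -> phi u = phi x + s%:~R * (u - x)) ->
  (dir = 1 /\ x <= t < z -> out_slope phi t dir s) /\
  (dir = -1 /\ x < t <= z -> out_slope phi t dir (- s)).
Proof.
move=> xz hphi; split=> -[-> /andP[h1 h2]].
- exists (z - t) => [|h /andP[hh1 hh2]]; first lra.
  by rewrite (hphi (t + _)) ?(hphi t); lra.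
- exists (t - x) => [|h /andP[hh1 hh2]]; first lra.
  by rewrite (hphi (t + _)) ?(hphi t) ?rmorphN /=; lra.
Qed.

Lemma out_slope_local phi psi t dir s :
  (exists2 e, 0 < e & forall h, 0 <= h < e -> phi (t + dir * h) = psi (t + dir * h)) ->
  out_slope phi t dir s -> out_slope psi t dir s.
Proof.
move=> [e e0 he] [d d0 hd]; exists (Num.min d e) => [|h]; first by rewrite lt_min d0.
rewrite lt_min => /and3P[h0 h1 h2]; rewrite -he ?hd ?h0 ?h1 //; last lra.
by have := he 0; rewrite mulr0 addr0 => -> //; rewrite lexx.
Qed.

Lemma breakpoints_mono (n : nat) (xs : nat -> R) :
  (forall i, (i < n)%N -> xs i < xs i.+1) ->
  forall j k, (j <= k)%N -> (k <= n)%N -> xs j <= xs k.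
Proof.
move=> hlt j; elim=> [|k IH]; first by rewrite leqn0 => /eqP ->.
rewrite leq_eqVlt => /predU1P[-> //|jk] kn.
by apply: le_trans (IH jk (ltnW kn)) _; apply/ltW/hlt.
Qed.

Lemma PL_on_ext phi psi x z : (forall t, x <= t <= z -> phi t = psi t) ->
  PL_on x z phi -> PL_on x z psi.
Proof.
move=> hpp [n [xs [s [x0 xn hlt haff]]]]; exists n, xs, s; split=> // i ilt t ht.
have mono := breakpoints_mono hlt.
have h1 := mono 0%N i isT (ltnW ilt); have h2 := mono i.+1 n ilt (leqnn n).
rewrite x0 in h1; rewrite xn in h2; have := hlt i ilt => hi.
by rewrite -(hpp t) -1?(hpp (xs i)) ?(haff i ilt t ht) //; lra.
Qed.

Lemma PL_on_cat phi x m z : PL_on x m phi -> PL_on m z phi -> PL_on x z phi.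
Proof.
move=> [n1 [x1 [s1 [x10 x1n lt1 aff1]]]] [n2 [x2 [s2 [x20 x2n lt2 aff2]]]].
pose xs i := if (i < n1)%N then x1 i else x2 (i - n1)%N.
have xsl i : (i <= n1)%N -> xs i = x1 i.
  rewrite /xs leq_eqVlt => /predU1P[->|->//]; by rewrite ltnn subnn x20 x1n.
have xsr i : (n1 <= i)%N -> xs i = x2 (i - n1)%N by rewrite /xs leqNgt => /negPf ->.
exists (n1 + n2)%N, xs, (fun i => if (i < n1)%N then s1 i else s2 (i - n1)%N).
split=> [||i hi|i hi t]; first by rewrite xsl.
- by rewrite xsr ?leq_addr // addKn.
- have [i1|i1] := ltnP i n1; first by rewrite !xsl ?lt1 // ltnW.
  by rewrite !xsr ?subSn ?lt2 //; lia.
- have [i1|i1] := ltnP i n1; first by rewrite !xsl ?(ltnW i1) //; apply: aff1.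
  by rewrite !xsr ?subSn //; [apply: aff2; lia|lia].
Qed.

Lemma PL_on_affine phi x z s : x < z ->
  (forall t, x <= t <= z -> phi t = phi x + s%:~R * (t - x)) -> PL_on x z phi.
Proof.
move=> xz hphi; exists 1%N, (fun i => if i is 0%N then x else z), (fun=> s).
by split=> // -[].
Qed.

Definition nonneg_order phi d t := exists m n,
  [/\ out_slope phi t 1 m, out_slope phi t (-1) n & 0 <= d t + (m + n)].

(** Slopes at a point are unique, so the assumed interior orders are those read off from the affine
    pieces, which are then concatenated one by one. *)
Lemma PL_on_edge_section phi d x z a b : x < z -> PL_on x z phi ->
  out_slope phi x 1 a -> out_slope phi z (-1) b ->
  (forall t, x < t < z -> nonneg_order phi d t) -> edge_section d x z (phi x) (phi z) a b.
Proof.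
move=> xz [n [xs [s [x0 xn hlt haff]]]] ha hb hint.
have mono := breakpoints_mono hlt.
have in_xz i t : (i < n)%N -> xs i < t < xs i.+1 -> x < t < z.
  by move=> hi; have := mono 0%N i isT (ltnW hi); have := mono i.+1 n hi (leqnn n); rewrite x0 xn; lra.
have sr i : (i < n)%N -> out_slope phi (xs i) 1 (s i).
  move=> hi; have [h _] := out_slope_affine (xs i) 1 (hlt i hi) (haff i hi).
  by apply: h; rewrite lexx hlt.
have sl i : (i < n)%N -> out_slope phi (xs i.+1) (-1) (- s i).
  move=> hi; have [_ h] := out_slope_affine (xs i.+1) (-1) (hlt i hi) (haff i hi).
  by apply: h; rewrite lexx hlt.
have seg i : (i < n)%N -> edge_section d (xs i) (xs i.+1) (phi (xs i)) (phi (xs i.+1)) (s i) (- s i).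
  move=> hi; apply: edge_section_affine (hlt i hi) _ _ (erefl _).
    move=> t ht; have [m [k [h1 h2]]] := hint t (in_xz i t hi ht).
    have [hr _] := out_slope_affine t 1 (hlt i hi) (haff i hi).
    have [_ hl] := out_slope_affine t (-1) (hlt i hi) (haff i hi).
    rewrite (out_slope_unique h1 (hr _)) ?(out_slope_unique h2 (hl _)); [|split=> //; lra..].
    by rewrite subrr addr0.
  by rewrite (haff i hi) // lexx ltW ?hlt.
have n0 : (0 < n)%N by rewrite lt0n; apply: contraTneq xz => n0; rewrite -xn n0 x0 ltxx.
have chain k : (k < n)%N ->
    edge_section d (xs 0%N) (xs k.+1) (phi (xs 0%N)) (phi (xs k.+1)) (s 0%N) (- s k).
  elim: k => [|k IH] hk; first exact: seg.
  apply: edge_section_cat (IH (ltnW hk)) (seg k.+1 hk) _.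
  have [|m [l [h1 h2]]] := hint (xs k.+1).
    have := edge_section_lt (IH (ltnW hk)); rewrite x0 => ->.
    by have := mono k.+2 n hk (leqnn n); have := hlt k.+1 hk; rewrite -xn; lra.
  by rewrite (out_slope_unique h1 (sr _ hk)) (out_slope_unique h2 (sl _ (ltnW hk))) [_ + - _]addrC.
have n1 : (n.-1 < n)%N by rewrite prednK.
have := chain n.-1 n1; rewrite prednK // x0 xn.
rewrite (out_slope_unique ha (s' := s 0%N)); last by rewrite -x0; apply: sr.
rewrite (out_slope_unique hb (s' := - s n.-1)) //.
by have := sl _ n1; rewrite prednK // xn.
Qed.

(** Functions on two adjacent pieces are glued at [m]; the joint condition becomes the order
    condition there. *)
Lemma edge_section_fun d x z y0 y1 a b : edge_section d x z y0 y1 a b ->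
  exists phi, [/\ PL_on x z phi, phi x = y0 /\ phi z = y1,
    out_slope phi x 1 a, out_slope phi z (-1) b &
    forall t, x < t < z -> nonneg_order phi d t].
Proof.
elim=> {x z y0 y1 a b} [x z y0 y1 s b xz hd -> ->|].
  pose phi t := y0 + s%:~R * (t - x).
  have hphi t : x <= t <= z -> phi t = phi x + s%:~R * (t - x) by rewrite /phi; lra.
  exists phi; split; first exact: PL_on_affine hphi.
  - by rewrite /phi subrr mulr0 addr0.
  - by have [h _] := out_slope_affine x 1 xz hphi; apply: h; lra.
  - by have [_ h] := out_slope_affine z (-1) xz hphi; apply: h; lra.
  - move=> t ht; exists s, (- s); rewrite subrr addr0; split; last exact: hd.
      by have [h _] := out_slope_affine t 1 xz hphi; apply: h; lra.
    by have [_ h] := out_slope_affine t (-1) xz hphi; apply: h; lra.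
move=> x m z y0 y1 y2 a b a' b' h1 [f [fpl [fx fm] fa fb fi]] h2 [g [gpl [gm gz] ga gb gi]] hm.
have xm := edge_section_lt h1; have mz := edge_section_lt h2.
pose phi t := if t <= m then f t else g t.
have phif t : t <= m -> f t = phi t by rewrite /phi => ->.
have phig t : m <= t -> g t = phi t.
  by move=> mt; rewrite /phi; case: leP => // tm; have -> : t = m; rewrite ?fm ?gm //; lra.
have fr t s : t < m -> out_slope f t 1 s -> out_slope phi t 1 s.
  move=> tm; apply: out_slope_local; exists (m - t) => [|h hh]; first lra.
  by apply: phif; lra.
have fl t s : t <= m -> out_slope f t (-1) s -> out_slope phi t (-1) s.
  by move=> tm; apply: out_slope_local; exists 1 => // h hh; apply: phif; lra.
have gr t s : m <= t -> out_slope g t 1 s -> out_slope phi t 1 s.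
  by move=> tm; apply: out_slope_local; exists 1 => // h hh; apply: phig; lra.
have gl t s : m < t -> out_slope g t (-1) s -> out_slope phi t (-1) s.
  move=> tm; apply: out_slope_local; exists (t - m) => [|h hh]; first lra.
  by apply: phig; lra.
exists phi; split.
- apply: (@PL_on_cat _ _ m).
    by apply: PL_on_ext fpl => t ht; apply: phif; lra.
  by apply: PL_on_ext gpl => t ht; apply: phig; lra.
- by rewrite -phif ?(ltW xm) // -phig ?(ltW mz).
- exact: fr.
- exact: gl.
- move=> t ht; case: (ltgtP t m) => [tm|mt|->].
  + have [|k [l [hk hl hkl]]] := fi t; first by lra.
    by exists k, l; split=> //; [apply: fr|apply: fl => //; apply: ltW].
  + have [|k [l [hk hl hkl]]] := gi t; first by lra.
    by exists k, l; split=> //; [apply: gr => //; apply: ltW|apply: gl].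
  + by exists a', b; split; [apply: gr|apply: fl|rewrite [a' + b]addrC].
Qed.

End PiecewiseAffine.

Lemma RD_nonemptyP (R : realType) (V E : finType) (src tgt : E -> V) (len : E -> R)
    (D : divisor R V E) : (forall e, 0 < len e) ->
  RD_nonempty src tgt len D <-> metric_nonempty src tgt len (coef D).
Proof.
move=> len0.
have fun0 f e : edge_fun src tgt len f e 0 = f (inl (src e)) by rewrite /edge_fun eqxx.
have fun1 f e : edge_fun src tgt len f e (len e) = f (inl (tgt e)).
  by rewrite /edge_fun gt_eqF // eqxx.
split=> [[f [frat ford]]|[y [a [b [hs hv]]]]].
- have /choice[k hk] := fun v : V => ford (inl v) isT.
  have /choice[a ha] : forall v, exists a : (E -> int) * (E -> int),
    [/\ forall e, src e = v -> out_slope (edge_fun src tgt len f e) 0 1 (a.1 e),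
        forall e, tgt e = v -> out_slope (edge_fun src tgt len f e) (len e) (-1) (a.2 e) &
        k v = inc src tgt a.1 a.2 v].
    by move=> v; have [[a [b [h1 h2 h3]]] _] := hk v; exists (a, b).
  (* The slopes supplied at a vertex are meaningful only on its own half-edges, so each end of [e]
     is read from the data of its own vertex. *)
  exists (fun v => f (inl v)), (fun e => (a (src e)).1 e), (fun e => (a (tgt e)).2 e).
  split=> [e|v]; last first.
    have [_ hle] := hk v; have [_ _ hkv] := ha v; rewrite addrC.
    by move: hle; rewrite hkv => /le_trans; apply; rewrite lerD2r; apply: le_inc => e ->.
  rewrite -fun0 -fun1; apply: PL_on_edge_section => //.
  + by have [h _ _] := ha (src e); apply: h.
  + by have [_ h _] := ha (tgt e); apply: h.
  + move=> t ht; have [n [[m [l [h1 h2 ->]]] hn]] := ford (inr (e, t)) ht.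
    by exists m, l; rewrite addrC.
- have /choice[phi hphi] := fun e => edge_section_fun (hs e).
  pose f (p : pt R V E) := match p with inl v => y v | inr (e, t) => phi e t end.
  have fE e t : edge_fun src tgt len f e t = phi e t.
    have [_ [h1 h2] _ _ _] := hphi e; rewrite /edge_fun.
    by case: eqP => [->|_] //; case: eqP => [->|_].
  have fE' e : edge_fun src tgt len f e = phi e by apply: funext => t.
  exists f; split=> [e|[v _|[e t] ht]]; first by rewrite fE'; have [] := hphi e.
  + exists (inc src tgt a b v); split; last by rewrite addrC.
    by exists a, b; split=> // e _; rewrite fE'; have [] := hphi e.
  + have [_ _ _ _ /(_ t ht)[m [n [h1 h2 h3]]]] := hphi e.
    by exists (m + n); split; [exists m, n; rewrite fE'|rewrite addrC].
Qed.

(** * Ranks *)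

Section PureRiemannRoch.
Context (R : realType) (V E : finType) (src tgt : E -> V) (len : E -> R).
Hypothesis V_gt0 : (0 < #|V|)%N.
Hypothesis conn : cut_connected src tgt.
Hypothesis len_gt0 : forall e, 0 < len e.
Implicit Types D K : divisor R V E.
Local Notation rank_ok := (rank_ok src tgt len).

(** Both differences have zero coefficients, hence are effective and of nonnegative degree. *)
Lemma deg_eq_coef D D' : coef D =1 coef D' -> deg D = deg D'.
Proof.
move=> hDD'; have := deg_effective (D := div_sub D D'); have := deg_effective (D := div_sub D' D).
rewrite !deg_sub => h1 h2.
have {}h1 : 0 <= deg D' - deg D by apply: h1 => p; rewrite coef_sub hDD' subrr.
have {}h2 : 0 <= deg D - deg D' by apply: h2 => p; rewrite coef_sub hDD' subrr.
lia.
Qed.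

(** If [D - E0] had no section, [complementary_divisor] would give an effective [G] of the degree
    tested for [D'] such that [D' + E0 - G] has none. But [D' - G] has a section, and adding the
    effective [E0] preserves it. *)
Lemma rank_ok_complement D D' k : is_div len D -> is_div len D' ->
  (forall p, valid_pt len p -> coef D' p = canonical_coef src tgt p - coef D p) ->
  rank_ok D' (k - (deg D - (#|E|%:Z - #|V|%:Z))) -> rank_ok D k.
Proof.
move=> hD hD' hcoef hrk E0 hE0 effE0 degE0; apply: contrapT.
rewrite RD_nonemptyP // => /(complementary_divisor V_gt0 conn len_gt0 (is_div_sub hD hE0)).
case=> G [hG G0 Gdeg]; apply.
have : RD_nonempty src tgt len (div_sub D' G).
  apply: hrk => // [p|]; first exact: coef_nonneg.
  by rewrite Gdeg deg_sub degE0; lia.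
rewrite RD_nonemptyP //; apply: metric_nonempty_mono => p hp.
by rewrite !coef_sub hcoef //; have := effE0 p; lia.
Qed.

Lemma deg_complement D D' : is_div len D -> is_div len D' ->
  (forall p, valid_pt len p -> coef D' p = canonical_coef src tgt p - coef D p) ->
  deg D' = 2 * (#|E|%:Z - #|V|%:Z) - deg D.
Proof.
move=> hD hD' hcoef; pose K := vertex_div R E (fun v => degree src tgt v - 2).
have hK : is_div len K by apply/allP => q /mapP[v _ ->].
have -> : deg D' = deg (div_sub K D).
  apply: deg_eq_coef => p; have [hp|hp] := boolP (valid_pt len p); last first.
    by rewrite coef_sub !(coef_invalid _ hp) ?subrr.
  rewrite coef_sub hcoef //; congr (_ - _); case: p {hp} => [v|x].
    by rewrite coef_vertex_div.
  by rewrite coef_vertex_div_edge.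
rewrite deg_sub deg_vertex_div big_split /= sum_inc !sumr_const.
by rewrite -[(1 + 1) *+ _]mulr_natr -[(- 2) *+ _]mulr_natr !natz; ring.
Qed.

(** [D] is in turn the complement of [D'], and by [deg_complement] the second shift cancels the
    first. *)
Lemma riemann_roch_rank_ok D D' k : is_div len D -> is_div len D' ->
  (forall p, valid_pt len p -> coef D' p = canonical_coef src tgt p - coef D p) ->
  rank_ok D k <-> rank_ok D' (k - (deg D - (#|E|%:Z - #|V|%:Z))).
Proof.
move=> hD hD' hcoef; split; last exact: rank_ok_complement.
move=> hk; apply: (rank_ok_complement hD' hD) => [p hp|]; first by rewrite hcoef //; lia.
by rewrite (deg_complement hD hD' hcoef); congr rank_ok: hk; lia.
Qed.

Lemma rank_ok_le_deg D k : is_div len D -> 0 <= k -> rank_ok D k -> k <= deg D.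
Proof.
move=> hD k0 hk; have /card_gt0P[v _] := V_gt0.
pose E0 : divisor R V E := [:: (inl v, k)].
have degE0 : deg E0 = k by rewrite /deg big_seq1.
have : RD_nonempty src tgt len (div_sub D E0).
  by apply: hk => // p; apply: coef_nonneg; rewrite /= k0.
rewrite RD_nonemptyP // => /(metric_nonempty_deg V_gt0 conn len_gt0 (is_div_sub hD _)).
by rewrite deg_sub degE0 subr_ge0; apply.
Qed.

Lemma rank_ok_neg D k : k < 0 -> rank_ok D k.
Proof. by move=> k0 E0 _ /deg_effective h hk; move: h; rewrite hk leNgt k0. Qed.

Lemma exists_rank D : is_div len D -> exists r, is_rank src tgt len D r.
Proof.
(* The index is the candidate rank plus one: [n = 0] stands for -1, which always qualifies since no
   effective divisor has negative degree. *)
move=> hD; pose P n := `[< rank_ok D (n%:Z - 1) >].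
have exP : exists n, P n by exists 0%N; apply/asboolP/rank_ok_neg.
have bP n : P n -> (n <= `|deg D|.+1)%N.
  case: n => [//|n] /asboolP hn.
  have := rank_ok_le_deg hD _ hn; lia.
case: (ex_maxnP exP bP) => m /asboolP hm mmax.
exists (m%:Z - 1); split=> // k hk; have [k0|k0] := ltP k 0; first by lia.
have : P `|(k + 1)%R|%N by apply/asboolP; congr rank_ok: hk; lia.
by move/mmax; lia.
Qed.

End PureRiemannRoch.

Lemma connected_cut_connected (V E : finType) (src tgt : E -> V) :
  connected_graph src tgt -> cut_connected src tgt.
Proof.
move=> conn S /set0Pn[u uS]; rewrite -subTset => /subsetPn[v _ vS]; apply: contrapT => hS.
suff : (u \in S) = (v \in S) by rewrite uS (negPf vS).
apply: closed_connect (conn u v) => x y /existsP[e] /orP[] /andP[/eqP <- /eqP <-];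
  apply: contrapT => he; apply: hS; exists e; apply/eqP => // he'; exact: he.
Qed.

(** * Weighted curves and the length of the attached loops *)

Section WeightedGraph.
Context (R : realType) (V E : finType) (src tgt : E -> V) (w : V -> nat) (len : E -> R).
Local Notation A := (aug_edge E w).
Local Notation asrc := (@aug_src V E src w).
Local Notation atgt := (@aug_tgt V E tgt w).
Local Notation alen := (@aug_len R V E w len).
Local Notation iota := (@iota_pt R V E w).

Implicit Types D : divisor R V E.

Lemma aug_connected : cut_connected src tgt -> cut_connected asrc atgt.
Proof. by move=> conn S S0 ST; have [e he] := conn S S0 ST; exists (inl e). Qed.

Lemma sum_loops v (m : int) : \sum_(x : loop_edge w | tag x == v) m = m *+ w v.
Proof.
have := sig_big_dep (pred1 v) (fun i (j : 'I_(w i)) => true) (fun _ _ => m).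
move=> h; rewrite -[RHS](_ : \sum_(i | i == v) \sum_(j : 'I_(w i)) m = _).
  by rewrite h; apply: eq_bigl => x; rewrite andbT.
by rewrite big_pred1_eq sumr_const card_ord.
Qed.

Lemma card_aug_edge : #|A|%:Z = #|E|%:Z + (\sum_v w v)%:Z.
Proof.
rewrite card_sum PoszD card_tagged sumnE big_map big_enum; congr (_ + Posz _).
by apply: eq_bigr => v _; rewrite card_ord.
Qed.

Lemma degree_aug v : degree asrc atgt v = (valency src tgt v)%:Z + 2 * (w v)%:Z.
Proof.
rewrite /degree /inc !big_sumType /= !sum_loops /valency PoszD !sumr_const !natz.
ring.
Qed.

Lemma genus_aug : genus E w = #|A|%:Z - #|V|%:Z + 1.
Proof. by rewrite /genus card_aug_edge; ring. Qed.

Lemma push_div_sub (V' E' : finType) (f : pt R V E -> pt R V' E') D D' :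
  push f (div_sub D D') = div_sub (push f D) (push f D').
Proof. by rewrite /push /div_sub map_cat -!map_comp. Qed.

Lemma is_div_iota eps D : is_div len D -> is_div (alen eps) (iota_div w D).
Proof. by apply: is_div_push => -[|[]]. Qed.

Lemma coef_iota_loop D x t : coef (iota_div w D) (inr (inr x, t)) = 0.
Proof. by rewrite /coef big_map big_pred0 // => -[[v|[e u]] k]; apply/eqP. Qed.

(** Each attached loop adds two to the degree of its vertex, matching the weight term of the
    canonical divisor of the weighted curve. *)
Lemma coef_iota_canonical_sub D p :
  coef (iota_div w (div_sub (canonical_div R src tgt w) D)) p =
  canonical_coef asrc atgt p - coef (iota_div w D) p.
Proof.
have pushE D' : iota_div w D' = push iota D' by [].
rewrite !pushE push_div_sub coef_sub; congr (_ - _).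
have -> : push iota (canonical_div R src tgt w) =
    vertex_div R A (fun v => degree asrc atgt v - 2).
  by rewrite /push /canonical_div /vertex_div -map_comp; apply: eq_map => v /=; rewrite degree_aug.
by case: p => [v|x]; rewrite ?coef_vertex_div ?coef_vertex_div_edge.
Qed.

Definition scale_loops (k : R) (p : pt R V A) : pt R V A :=
  match p with inr (inr x, t) => inr (inr x, k * t) | _ => p end.

Lemma metric_nonempty_scale_loops (eps eps' : R) (D : pt R V A -> int) : 0 < eps -> 0 < eps' ->
  metric_nonempty asrc atgt (alen eps) D ->
  metric_nonempty asrc atgt (alen eps') (D \o scale_loops (eps / eps')).
Proof.
move=> e0 e'0 [y [a [b [hs hv]]]]; exists y, a, b; split=> [[e|x]|v]; [exact: (hs (inl e))| |exact: hv].
have k0 : 0 < eps' / eps by rewrite divr_gt0.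
pose d' t := (D \o scale_loops (eps / eps')) (inr (inr x, t)).
(* The shift is chosen so that scaling fixes the value [y (tag x)] at the base vertex. *)
have := @edge_section_image _ _ d' _ 0 (y (tag x) - eps' / eps * y (tag x)) _ _ _ _ _ _ k0 (hs (inr x)).
rewrite mulr0 !addr0 /= divfK ?gt_eqF // addrC subrK; apply=> t _.
by rewrite /d' /= addr0 mulrA mulf_div [eps * eps']mulrC divff ?mul1r // mulf_neq0 ?gt_eqF.
Qed.

(** Test divisors are carried from one loop length to the other by [s]; the image of [D] has no
    points inside the loops and is unaffected. *)
Lemma rank_ok_scale_loops (eps eps' : R) D k : (forall e, 0 < len e) -> is_div len D ->
  0 < eps -> 0 < eps' ->
  rank_ok asrc atgt (alen eps) (iota_div w D) k -> rank_ok asrc atgt (alen eps') (iota_div w D) k.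
Proof.
move=> len0 hD e0 e'0 hk E0 hE0 effE0 degE0.
have al0 d : 0 < d -> forall e, 0 < alen d e by move=> d0 [].
pose s := scale_loops (eps / eps'); pose s' := scale_loops (eps' / eps).
have kk : (eps / eps') * (eps' / eps) = 1 by rewrite mulf_div [eps * eps']mulrC divff // mulf_neq0 ?gt_eqF.
have ss' p : s (s' p) = p by case: p => [//|[[//|x] t]]; rewrite /s /s' /= mulrA kk mul1r.
have s's p : s' (s p) = p by case: p => [//|[[//|x] t]]; rewrite /s /s' /= mulrA [_ * (eps / _)]mulrC kk mul1r.
have sv p : valid_pt (alen eps') p -> valid_pt (alen eps) (s p).
  case: p => [//|[[//|x] t]] /= /andP[t0 te]; rewrite mulr_gt0 ?divr_gt0 //=.
  by rewrite mulrAC ltr_pdivrMr // ltr_pM2l.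
have hE1 : is_div (alen eps) (push s E0) by apply: is_div_push hE0 => p; apply: sv.
have coefE1 p : coef (push s E0) p = coef E0 (s' p).
  by apply: (coef_push hE0) => [q _|]; rewrite ?s's ?ss'.
have : RD_nonempty asrc atgt (alen eps) (div_sub (iota_div w D) (push s E0)).
  by apply: hk; rewrite ?deg_push // => p; rewrite coefE1.
rewrite RD_nonemptyP; last exact: al0.
move/(metric_nonempty_scale_loops e0 e'0); rewrite RD_nonemptyP; last exact: al0.
apply: metric_nonempty_mono => p hp; rewrite /= !coef_sub -/(s p) coefE1 s's.
by case: p {hp} => [//|[[//|x] t]]; rewrite /s /= !coef_iota_loop.
Qed.

End WeightedGraph.

Unset Implicit Arguments.

Theorem theorem5p4 (R : realType) (V E : finType) (src tgt : E -> V)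
    (w : V -> nat) (len : E -> R) :
  (0 < #|V|)%N -> connected_graph src tgt -> (forall e, 0 < len e) ->
  forall D : divisor R V E, is_div len D ->
  exists rD rKD : int,
    [/\ (forall eps : R, 0 < eps -> weighted_rank_at src tgt w len eps D rD),
        (forall eps : R, 0 < eps ->
           weighted_rank_at src tgt w len eps (div_sub (canonical_div R src tgt w) D) rKD) &
        rD - rKD = deg D - genus E w + 1].
Proof.
move=> V_gt0 /connected_cut_connected conn len_gt0 D hD.
set D' := div_sub _ _.
have hD' : is_div len D'.
  by apply: is_div_sub => //; apply/allP => q /mapP[v _ ->].
have aconn := aug_connected w conn.
have al0 (eps : R) : 0 < eps -> forall e, 0 < aug_len (w := w) len eps e by move=> e0 [].
have hcoef (p : pt R V (aug_edge E w)) : coef (iota_div w D') p =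
    canonical_coef (aug_src src (w := w)) (aug_tgt tgt (w := w)) p - coef (iota_div w D) p.
  exact: coef_iota_canonical_sub.
pose c := deg D - genus E w + 1.
have rr (eps : R) k : 0 < eps ->
    rank_ok (aug_src src (w := w)) (aug_tgt tgt (w := w)) (aug_len len eps) (iota_div w D) k <->
    rank_ok (aug_src src (w := w)) (aug_tgt tgt (w := w)) (aug_len len eps) (iota_div w D') (k - c).
  move=> e0; have -> : c = deg (iota_div w D) - (#|aug_edge E w|%:Z - #|V|%:Z).
    by rewrite /c genus_aug deg_push; lia.
  apply: (riemann_roch_rank_ok V_gt0 aconn (al0 _ e0) k (is_div_iota w eps hD) (is_div_iota w eps hD')).
  by move=> p _; apply: hcoef.
(* Loop length 1 serves as reference; [rank_ok_scale_loops] compares it with every [eps] in both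
   directions. *)
have [r [hr rmax]] := exists_rank V_gt0 aconn (al0 _ ltr01) (is_div_iota w 1 hD).
have rk (eps : R) : 0 < eps -> weighted_rank_at src tgt w len eps D r.
  move=> e0; split; first exact: rank_ok_scale_loops len_gt0 hD ltr01 e0 hr.
  by move=> k /(rank_ok_scale_loops len_gt0 hD e0 ltr01); apply: rmax.
(* By [rr] the degrees allowed for [D'] are those for [D] shifted down by [c], hence so is their
   maximum. *)
exists r, (r - c); split=> //; last by rewrite /c; lia.
move=> eps e0; have [h1 h2] := rk eps e0; split; first exact/rr.
move=> k hk; suff : k + c <= r by lia.
by apply/h2/(rr _ _ e0); rewrite addrK.
Qed.
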